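(* Let $\chi_1,\chi_2:\mathbb{R}^{2d}\to\mathbb{R}^{2d}$ be transformations satisfying B1 and B2. If $T^{(i)}\in FIO(\chi_i,s_i)$ with $s_i>2d$, $i=1,2$, then the composition $T^{(1)}T^{(2)}$ is in $FIO(\chi_1\circ\chi_2,s)$ with $s=\min(s_1,s_2)$. Consequently, for $s>2d$, the class $FIO(\Xi,s)=\bigcup_\chi FIO(\chi,s)$ is an algebra with respect to the composition of operators.
   Context: Notation: $\langle z\rangle=(1+|z|^2)^{1/2}$. For $z=(x,\eta)\in\mathbb{R}^{2d}$, $\pi(z)f(t)=e^{2\pi i t\cdot\eta}f(t-x)$. The bracket $\langle f,g\rangle$ extends the inner product $\int f\overline{g}$ of $L^2(\mathbb{R}^d)$ to $\mathcal{S}'(\mathbb{R}^d)\times\mathcal{S}(\mathbb{R}^d)$. Conditions on $\chi$. B1: $\chi:\mathbb{R}^{2d}\to\mathbb{R}^{2d}$ is smooth, invertible, and preserves the symplectic form, i.e. with $(x,\xi)=\chi(y,\eta)$ one has $dx\wedge d\xi=dy\wedge d\eta$. B2: for every multi-index $\alpha$ with $|\alpha|\ge1$ there is $C_\alpha$ with $|\partial_z^\alpha\chi(z)|\le C_\alpha$ for all $z\in\mathbb{R}^{2d}$. Parseval frames: for a lattice $\Lambda=A\mathbb{Z}^{2d}$, $A\in GL(2d,\mathbb{R})$, and $g\in L^2(\mathbb{R}^d)$, the system $\mathcal{G}(g,\Lambda)=\{\pi(\lambda)g:\lambda\in\Lambda\}$ is a Parseval frame if $f=\sum_{\lambda\in\Lambda}\langle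 f,\pi(\lambda)g\rangle\pi(\lambda)g$ for all $f\in L^2(\mathbb{R}^d)$, equivalently $\sum_{\lambda\in\Lambda}|\langle f,\pi(\lambda)g\rangle|^2=\|f\|_2^2$. The class $FIO(\chi,s)$, $s\ge0$: fix a Parseval frame $\mathcal{G}(g,\Lambda)$ for $L^2(\mathbb{R}^d)$ with $g\in\mathcal{S}(\mathbb{R}^d)\setminus\{0\}$. A continuous linear operator $T:\mathcal{S}(\mathbb{R}^d)\to\mathcal{S}'(\mathbb{R}^d)$ belongs to $FIO(\chi,s)$ if there is $C>0$ with $|\langle T\pi(\lambda)g,\pi(\mu)g\rangle|\le C\langle\mu-\chi(\lambda)\rangle^{-s}$ for all $\lambda,\mu\in\Lambda$. The union $FIO(\Xi,s)=\bigcup_\chi FIO(\chi,s)$ is over all $\chi$ satisfying B1 and B2. For $s>2d$ every operator in $FIO(\chi,s)$ extends to a bounded operator on $L^2(\mathbb{R}^d)$; the composition $T^{(1)}T^{(2)}$ is that of these bounded extensions.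
   Formalization: ''Algebra'' is read as closure of FIO(Ξ,s) under composition and scalar multiples, with sums only within one FIO(χ,s): the union over χ is not closed under addition (the identity plus the Fourier transform lies in no FIO(χ,s)). *)

(* Defs.v *)
From HB Require Import structures.
From mathcomp Require Import all_boot all_order all_algebra finmap.
From mathcomp Require Import all_classical all_reals all_analysis.
From mathcomp Require Import complex.

Set Implicit Arguments.
Unset Strict Implicit.
Unset Printing Implicit Defensive.

Import Order.TTheory GRing.Theory Num.Theory.
Import numFieldNormedType.Exports Normc.

Local Open Scope classical_set_scope.
Local Open Scope ring_scope.

Definition rV_display : measure_display. Proof. exact: default_measure_display. Qed.

(* The Borel sets of R^n, generated by the coordinate functions. *)
Section measurable_rV.
Context {R : realType} (n : nat).

Definition rV_coord (i : 'I_n) (v : 'rV[R]_n) : measurableTypeR R := v ord0 i.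

Let rV_set0 : g_sigma_preimage rV_coord set0.
Proof. exact: sigma_algebra0. Qed.

Let rV_setC A : g_sigma_preimage rV_coord A -> g_sigma_preimage rV_coord (~` A).
Proof. exact: sigma_algebraC. Qed.

Let rV_bigcup (F : _^nat) : (forall i, g_sigma_preimage rV_coord (F i)) ->
  g_sigma_preimage rV_coord (\bigcup_i (F i)).
Proof. exact: sigma_algebra_bigcup. Qed.

HB.instance Definition _ := @isMeasurable.Build rV_display
  'rV[R]_n (g_sigma_preimage rV_coord) rV_set0 rV_setC rV_bigcup.

Lemma measurable_rV_coord i : measurable_fun setT (rV_coord i).
Proof.
move=> _ Y mY; rewrite setTI; apply: sub_sigma_algebra => /=.
rewrite -bigcup_seq/=; exists i => /=; first by rewrite mem_index_enum.
by exists Y => //; rewrite setTI.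
Qed.

Lemma measurable_fun_rV d (T : measurableType d) (f : T -> 'rV[R]_n) :
  (forall i, measurable_fun setT (rV_coord i \o f)) -> measurable_fun setT f.
Proof.
move=> mf; suff : g_sigma_preimage (fun i => rV_coord i \o f) `<=` measurable.
  by rewrite g_sigma_preimage_comp => h _ A mA; apply: h; exists A.
apply: smallest_sub; first exact: sigma_algebra_measurable.
move=> A; rewrite -bigcup_seq => -[i _] [B mB <-].
exact: mf.
Qed.

End measurable_rV.

Section lebesgue_rV.
Context {R : realType}.
Local Notation mR := (measurableTypeR R).

Definition rV_cons n (p : mR * 'rV[R]_n) : 'rV[R]_n.+1 :=
  row_mx (p.1 : R)%:M p.2.

Definition rV_uncons n (v : 'rV[R]_n.+1) : mR * 'rV[R]_n :=
  (v ord0 ord0, \row_i v ord0 (lift ord0 i)).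

Lemma rV_cons0 n p : rV_coord ord0 (@rV_cons n p) = p.1.
Proof.
rewrite /rV_coord /rV_cons.
have -> : (ord0 : 'I_n.+1) = lshift n (ord0 : 'I_1) by apply/val_inj.
by rewrite (@row_mxEl _ 1 1 n) mxE.
Qed.

Lemma rV_consS n p i : rV_coord (lift ord0 i) (@rV_cons n p) = rV_coord i p.2.
Proof.
rewrite /rV_coord /rV_cons.
have -> : lift ord0 i = rshift 1 i :> 'I_(1 + n) by apply/val_inj.
by rewrite (@row_mxEr _ 1 1 n).
Qed.

Lemma rV_consK n : cancel (@rV_cons n) (@rV_uncons n).
Proof.
move=> [x v]; rewrite /rV_uncons.
congr (_, _); first exact: (rV_cons0 (x, v)).
by apply/rowP => i; rewrite mxE; exact: (rV_consS (x, v)).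
Qed.

Lemma measurable_rV_cons n : measurable_fun setT (@rV_cons n).
Proof.
apply: measurable_fun_rV => i; case: (unliftP ord0 i) => [j|] ->.
  have -> : rV_coord (lift ord0 j) \o @rV_cons n = rV_coord j \o snd.
    by apply/funext => p; exact: rV_consS.
  exact: measurableT_comp (measurable_rV_coord j) measurable_snd.
have -> : rV_coord ord0 \o @rV_cons n = fst.
  by apply/funext => p; exact: rV_cons0.
exact: measurable_fst.
Qed.

Lemma measurable_rV_uncons n : measurable_fun setT (@rV_uncons n).
Proof.
apply/measurable_fun_pairP; split; first exact: measurable_rV_coord.
apply: measurable_fun_rV => i.
rewrite (_ : _ \o _ = rV_coord (lift ord0 i)); last first.
  by apply/funext => v /=; rewrite /rV_coord mxE.
exact: measurable_rV_coord.
Qed.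

Section cons_measure.
Variables (n : nat) (m : {sigma_finite_measure set 'rV[R]_n -> \bar R}).

Definition cons_measure : set 'rV[R]_n.+1 -> \bar R :=
  pushforward (@lebesgue_measure R \x m)%E (@rV_cons n).

Let mu0 : cons_measure set0 = 0%E.
Proof. by rewrite /cons_measure /pushforward preimage_set0 measure0. Qed.

Let mu_ge0 A : (0 <= cons_measure A)%E.
Proof. by rewrite /cons_measure /pushforward measure_ge0. Qed.

Let mu_sigma : semi_sigma_additive cons_measure.
Proof.
move=> F mF tF mUF; rewrite /cons_measure /pushforward preimage_bigcup.
have mp A : measurable A -> measurable (@rV_cons n @^-1` A).
  by move=> mA; rewrite -[X in measurable X]setTI; exact: measurable_rV_cons.
apply: measure_semi_sigma_additive.
- by move=> k; exact: mp.
- apply/trivIsetP => /= i j _ _ ij; rewrite -preimage_setI.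
  by move/trivIsetP : tF => /(_ _ _ _ _ ij) ->//; rewrite preimage_set0.
- by rewrite -preimage_bigcup; exact: mp.
Qed.

HB.instance Definition _ :=
  isMeasure.Build _ _ _ cons_measure mu0 mu_ge0 mu_sigma.

Let mu_sigma_finite : sigma_finite setT cons_measure.
Proof.
have /sigma_finiteP[F [FT ndF Foo]] := sigma_finiteT (@lebesgue_measure R).
have /sigma_finiteP[G [GT ndG Goo]] := sigma_finiteT m.
exists (fun k => @rV_uncons n @^-1` (F k `*` G k)).
  rewrite -preimage_bigcup (_ : \bigcup_k _ = setT) ?preimage_setT//.
  apply/seteqP; split => // -[x y] _.
  have [k _ Fkx] : (\bigcup_i F i) x by rewrite -FT.
  have [l _ Gly] : (\bigcup_i G i) y by rewrite -GT.
  exists (maxn k l) => //; split.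
    by move: x Fkx; exact/subsetPset/ndF/leq_maxl.
  by move: y Gly; exact/subsetPset/ndG/leq_maxr.
move=> k; have [mF Fk] := Foo k; have [mG Gk] := Goo k; split.
  rewrite -[X in measurable X]setTI; apply: measurable_rV_uncons => //.
  exact: measurableX.
rewrite /cons_measure /pushforward -comp_preimage.
rewrite (_ : _ \o _ = id); last by apply/funext => p; exact: rV_consK.
by rewrite preimage_id product_measure1E// lte_mul_pinfty// ge0_fin_numE.
Qed.

HB.instance Definition _ :=
  Measure_isSigmaFinite.Build _ _ _ cons_measure mu_sigma_finite.

End cons_measure.

(* Lebesgue measure on R^n.+1 = R x R^n as a product measure. *)
Fixpoint lebesgue_rV (n : nat) : {sigma_finite_measure set 'rV[R]_n -> \bar R} :=
  match n with
  | 0 => dirac (0 : 'rV[R]_0)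
  | n'.+1 => cons_measure (lebesgue_rV n')
  end.

End lebesgue_rV.

Section smooth_functions.
Context {R : realType}.

(* [a] lists the variables to differentiate in; the order of the list is
   irrelevant for smooth functions, so lists of length k stand for the
   multi-indices of length k. *)
Definition partials n (V : normedModType R) (a : seq 'I_n)
    (f : 'rV[R]_n -> V) : 'rV[R]_n -> V :=
  foldr (fun i h x => 'D_(delta_mx ord0 i) h x) f a.

Definition smooth n (V : normedModType R) (f : 'rV[R]_n -> V) : Prop :=
  forall (a : seq 'I_n) x, differentiable (partials a f) x.

Definition dot n (u v : 'rV[R]_n) : R := \sum_i u ord0 i * v ord0 i.

(* The norm the library puts on ['rV[R]_n] is the sup norm. *)
Definition enorm n (v : 'rV[R]_n) : R := Num.sqrt (dot v v).

Definition japanese n (v : 'rV[R]_n) : R := Num.sqrt (1 + enorm v ^+ 2).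

End smooth_functions.

Section canonical_transformations.
Context {R : realType} (d : nat).
Local Notation phase := 'rV[R]_(d + d).

(* The form dx /\ dxi, a point being [row_mx x xi]. *)
Definition symp (u v : phase) : R :=
  dot (lsubmx u) (rsubmx v) - dot (rsubmx u) (lsubmx v).

(* The last clause says that [chi] pulls the symplectic form back to itself. *)
Definition condB1 (chi : phase -> phase) : Prop :=
  [/\ smooth chi, bijective chi &
      forall z u v, symp ('d chi z u) ('d chi z v) = symp u v].

Definition condB2 (chi : phase -> phase) : Prop :=
  forall a : seq 'I_(d + d), (1 <= size a)%N ->
    exists C : R, forall z, enorm (partials a chi z) <= C.

End canonical_transformations.

Section function_spaces.
Context {R : realType} {d : nat}.
Local Notation C := R[i].
Local Notation point := 'rV[R]_d.
Local Notation mu := (@lebesgue_rV R d).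

Definition re_part (f : point -> C) : point -> R := fun t => complex.Re (f t).
Definition im_part (f : point -> C) : point -> R := fun t => complex.Im (f t).

Definition cintegral (f : point -> C) : C :=
  Complex (\int[mu]_t re_part f t) (\int[mu]_t im_part f t).

Definition inner (f g : point -> C) : C :=
  cintegral (fun t => f t * conjc (g t)).

(* Elements of L^2 are represented by functions, not by classes. *)
Definition L2 (f : point -> C) : Prop :=
  [/\ measurable_fun setT (re_part f),
      measurable_fun setT (im_part f) &
      (\int[mu]_t ((normc (f t)) ^+ 2)%:E < +oo)%E].

Definition L2norm (f : point -> C) : R :=
  Num.sqrt (\int[mu]_t ((normc (f t)) ^+ 2)).

Definition cpartials (a : seq 'I_d) (f : point -> C) (t : point) : C :=
  Complex (partials a (re_part f) t)
          (partials a (im_part f) t).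

Definition monomial (a : seq 'I_d) (t : point) : R := \prod_(i <- a) t ord0 i.

Definition schwartz_weight (p : seq 'I_d * seq 'I_d) (f : point -> C)
  (t : point) : R := normc ((monomial p.1 t)%:C%C * cpartials p.2 f t).

Definition schwartz (f : point -> C) : Prop :=
  [/\ smooth (re_part f),
      smooth (im_part f) &
      forall p, exists M : R, forall t, schwartz_weight p f t <= M].

Definition seminorm (p : seq 'I_d * seq 'I_d) (f : point -> C) : R :=
  sup (range (schwartz_weight p f)).

(* Continuity at 0, hence everywhere for linear [u], with respect to the
   Frechet topology of the Schwartz space. *)
Definition schwartz_continuous (u : (point -> C) -> C) : Prop :=
  exists (K : R) (P : seq (seq 'I_d * seq 'I_d)),
    forall f, schwartz f -> normc (u f) <= K * \sum_(p <- P) seminorm p f.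

(* Functionals and operators are functions on all of [point -> C], but only
   their values on Schwartz functions are ever used. *)
Definition tempered (u : (point -> C) -> C) : Prop :=
  (forall (a : C) f g, schwartz f -> schwartz g ->
     u (fun t => a * f t + g t) = a * u f + u g) /\
  schwartz_continuous u.

Definition bracket (u : (point -> C) -> C) (h : point -> C) : C :=
  u (fun t => conjc (h t)).

Definition distribution_of (f : point -> C) : (point -> C) -> C :=
  fun h => cintegral (fun t => f t * h t).

Definition operator := (point -> C) -> (point -> C) -> C.

(* Continuity is for the weak-* topology of tempered distributions; the strong
   topology gives the same operators because the Schwartz space is barrelled. *)
Definition continuous_operator (T : operator) : Prop :=
  [/\ forall f, schwartz f -> tempered (T f),
      forall (a : C) f g h, schwartz f -> schwartz g -> schwartz h ->
        T (fun t => a * f t + g t) h = a * T f h + T g h &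
      forall h, schwartz h -> schwartz_continuous (fun f => T f h)].

(* Linearity and boundedness make [B] compatible with equality a.e. *)
Definition bounded_L2 (B : (point -> C) -> (point -> C)) : Prop :=
  [/\ forall f, L2 f -> L2 (B f),
      forall (a : C) f g, L2 f -> L2 g ->
        {ae mu, forall t, B (fun x => a * f x + g x) t = a * B f t + B g t} &
      exists K : R, forall f, L2 f -> L2norm (B f) <= K * L2norm f].

Definition L2_extension (T : operator) (B : (point -> C) -> (point -> C)) :
    Prop :=
  bounded_L2 B /\
  forall f h, schwartz f -> schwartz h -> T f h = distribution_of (B f) h.

(* The composition goes through the bounded extensions to L^2, which are
   determined a.e. by [T1] and [T2] since Schwartz functions are dense. *)
Definition is_composition (T1 T2 T : operator) : Prop :=
  exists B1 B2, [/\ L2_extension T1 B1, L2_extension T2 B2 &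
    forall f h, schwartz f -> schwartz h ->
      T f h = distribution_of (B1 (B2 f)) h].

Definition scale_operator (a : C) (T : operator) : operator :=
  fun f h => a * T f h.

Definition add_operator (T1 T2 : operator) : operator :=
  fun f h => T1 f h + T2 f h.

End function_spaces.

Arguments operator R d : clear implicits.

Section gabor.
Context {R : realType} {d : nat}.
Local Notation C := R[i].
Local Notation point := 'rV[R]_d.
Local Notation phase := 'rV[R]_(d + d).

Definition expi (x : R) : C := Complex (cos x) (sin x).

Definition tf_shift (z : phase) (f : point -> C) : point -> C :=
  fun t => expi (2 * pi * dot t (rsubmx z)) * f (t - lsubmx z).

(* [A k] for the column vector [k], in row notation. *)
Definition lattice_point (A : 'M[R]_(d + d)) (k : 'rV[int]_(d + d)) : phase :=
  map_mx intr k *m A^T.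

Definition lattice (A : 'M[R]_(d + d)) : set phase := range (lattice_point A).

(* The frame expansion converges unconditionally in L^2; the sum over the
   lattice is indexed by Z^2d, [lattice_point A] being injective when [A] is
   invertible. *)
Definition parseval_frame (A : 'M[R]_(d + d)) (g : point -> C) : Prop :=
  forall f, L2 f -> forall e : R, 0 < e ->
    exists F0 : {fset 'rV[int]_(d + d)},
      forall F : {fset 'rV[int]_(d + d)}, (F0 `<=` F)%fset ->
        L2norm (fun t => f t - \sum_(k <- F)
          inner f (tf_shift (lattice_point A k) g) *
          tf_shift (lattice_point A k) g t) < e.

Definition FIO (A : 'M[R]_(d + d)) (g : point -> C) (chi : phase -> phase)
    (s : R) (T : operator R d) : Prop :=
  continuous_operator T /\
  exists2 K : R, 0 < K &
    forall l m : phase, lattice A l -> lattice A m ->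
      normc (bracket (T (tf_shift l g)) (tf_shift m g))
        <= K * japanese (m - chi l) `^ (- s).

Definition FIO_union (A : 'M[R]_(d + d)) (g : point -> C) (s : R)
    (T : operator R d) : Prop :=
  exists chi, [/\ condB1 chi, condB2 chi & FIO A g chi s T].

End gabor.

(* Main.v *)
(** Expanding [B2 (pi(l) g)] in the Parseval frame bounds the Gabor matrix of a
    composition by the product of the Gabor matrices,
    [sum_k <m - chi1 k>^(-s1) <k - chi2 l>^(-s2)].
    As [chi1] is Lipschitz, one of the two factors of each term is dominated by
    [<m - chi1 (chi2 l)>^(-s)]; the remaining factor is summable over the
    lattice because [s > 2d], provided that [<k - chi1^-1 m>] is dominated by
    [<m - chi1 k>].  That lower bound holds since the derivative of [chi1] is a
    bounded symplectic matrix, so its inverse is bounded as well, and the second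
    derivatives are bounded: a contraction argument shows that [chi1] maps every
    ball of a fixed radius onto a set containing a ball of another fixed radius,
    and [chi1] is injective.

    All decay estimates use [1 + `|z|] for the sup norm, which is equivalent to
    the Japanese bracket. *)

From HB Require Import structures.
Require Import Defs.
From mathcomp Require Import all_boot all_order all_algebra finmap.
From mathcomp Require Import all_classical all_reals all_analysis.
From mathcomp Require Import measurable_realfun complex ring lra zify.

Set Implicit Arguments.
Unset Strict Implicit.
Unset Printing Implicit Defensive.

Import Order.TTheory GRing.Theory Num.Theory.
Import numFieldNormedType.Exports Normc.

Local Open Scope classical_set_scope.
Local Open Scope ring_scope.

(** * Iterated partial derivatives *)

Section partial_derivatives.
Context {R : realType}.

(** Membership of the composition in the class includes continuity from Schwartz functions to
    tempered distributions; this follows from the L^2 bounds alone, because finitely many Schwartz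
    seminorms dominate the L^2 norm. The bounded extensions act on functions and are linear only
    almost everywhere, so they are studied through the functionals [f |-> <B f, h>], which are
    exactly linear on L^2. Such a functional is L^2-continuous: a bound on all finite partial sums
    of the frame expansion passes to the limit, and no infinite series over the lattice is formed.
    Lattice sums are therefore bounded uniformly over finite duplicate-free families. The lower
    bound on [chi1] is a large-scale one: the summand 1 in [1 + |z|] absorbs the radius of the
    balls. Surjectivity onto balls of uniform size and injectivity suffice for it, without
    differentiating the inverse map. Closure under derivatives occurs twice, with boundedness (B2
    for [chi1 \o chi2]) and with rapid decay (time-frequency shifts of [g]), so it is proved for an
    abstract growth condition. *)

Definition partial n (V : normedModType R) (i : 'I_n) (f : 'rV[R]_n -> V)
  : 'rV[R]_n -> V := fun x => 'D_(delta_mx ord0 i) f x.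

Lemma partials_rcons n (V : normedModType R) (a : seq 'I_n) i
    (f : 'rV[R]_n -> V) : partials (rcons a i) f = partials a (partial i f).
Proof. by rewrite /partials foldr_rcons. Qed.

Lemma partialD n i (f g : 'rV[R]_n -> R) :
  (forall x, differentiable f x) -> (forall x, differentiable g x) ->
  partial i (fun x => f x + g x) = fun x => partial i f x + partial i g x.
Proof.
move=> df dg; apply/funext => x.
by apply: (@deriveD _ _ _ f g); exact: diff_derivable.
Qed.

Lemma partialM n i (f g : 'rV[R]_n -> R) :
  (forall x, differentiable f x) -> (forall x, differentiable g x) ->
  partial i (fun x => f x * g x) =
  fun x => f x * partial i g x + partial i f x * g x.
Proof.
move=> df dg; apply/funext => x.
rewrite [RHS](_ : _ = f x *: partial i g x + g x *: partial i f x); last first.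
  by rewrite /GRing.scale/= [g x * _]mulrC.
by apply: (@deriveM _ _ f g); exact: diff_derivable.
Qed.

Lemma partial_cst n i (c : R) : partial i (fun=> c : R) = fun _ : 'rV[R]_n => 0.
Proof. by apply/funext => x; exact: derive_cst. Qed.

Lemma differentiable_row n m (f : 'rV[R]_n -> 'rV[R]_m) x :
  (forall j, differentiable (fun z => f z ord0 j) x) -> differentiable f x.
Proof.
move=> df.
have -> : f = fun z => \sum_j f z ord0 j *: delta_mx ord0 j.
  by apply/funext => z; exact: row_sum_delta.
rewrite (_ : (fun z => _) = \sum_j (fun z => f z ord0 j *: delta_mx ord0 j)).
  by apply: differentiable_sum => j; apply: differentiableZl.
by apply/funext => z; rewrite fct_sumE.
Qed.

Lemma differentiable_coord_comp n m (f : 'rV[R]_n -> 'rV[R]_m) x j :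
  differentiable f x -> differentiable (fun z => f z ord0 j) x.
Proof.
by move=> df; apply: (@differentiable_comp _ _ _ _ f (fun M => M ord0 j));
  last exact: differentiable_coord.
Qed.

Lemma partial_row n m i (f : 'rV[R]_n -> 'rV[R]_m) x j :
  differentiable f x ->
  partial i f x ord0 j = partial i (fun z => f z ord0 j) x.
Proof.
move=> df; rewrite /partial derive_mx ?mxE//; exact: diff_derivable.
Qed.

Lemma partial_comp n m i (f : 'rV[R]_m -> R) (h : 'rV[R]_n -> 'rV[R]_m) :
  (forall x, differentiable f x) -> (forall x, differentiable h x) ->
  partial i (f \o h) =
  fun x => \sum_j partial j f (h x) * partial i (fun z => h z ord0 j) x.
Proof.
move=> df dh; apply/funext => x.
rewrite {1}/partial deriveE; last exact: differentiable_comp.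
rewrite diff_comp//= -(@deriveE _ _ _ h)// -/(partial i h x).
rewrite [partial i h x]row_sum_delta linear_sum.
apply: eq_bigr => j _; rewrite linearZ/= -deriveE// -/(partial j f _).
by rewrite partial_row// /GRing.scale/= mulrC.
Qed.

(* [P] is meant to be a growth condition, such as boundedness or rapid decay;
   the recursion peels off the innermost derivative, so that product and chain
   rule give inductions on [k]. *)
Fixpoint regular n (P : set ('rV[R]_n -> R)) (k : nat) (f : 'rV[R]_n -> R)
  : Prop :=
  [/\ forall x, differentiable f x, P f &
      if k is k'.+1 then forall i, regular P k' (partial i f) else True].

Lemma regular_diff n (P : set ('rV[R]_n -> R)) k f :
  regular P k f -> forall x, differentiable f x.
Proof. by case: k => [|k] []. Qed.

Lemma regular_in n (P : set ('rV[R]_n -> R)) k f : regular P k f -> P f.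
Proof. by case: k => [|k] []. Qed.

Lemma regularS n (P : set ('rV[R]_n -> R)) k f :
  regular P k.+1 f -> regular P k f.
Proof.
elim: k f => [|k IH] f; first by case.
by move=> [df Pf H]; split => // i; exact/IH/H.
Qed.

(** [partials] adds derivatives on the outside, [regular] on the inside; induction from the end of
    the list reconciles the two. *)
Lemma regularP n (P : set ('rV[R]_n -> R)) f :
  (forall k, regular P k f) <->
  forall a, (forall x, differentiable (partials a f) x) /\ P (partials a f).
Proof.
split=> [H a|].
  elim/last_ind: a f H => [|a i IH] f H.
    by have [dfx Pf _] := H 0%N.
  rewrite partials_rcons; apply: IH => k.
  by have [_ _] := H k.+1; apply.
move=> H k; elim: k f H => [|k IH] f H.
  by have [? ?] := H [::].
have [? ?] := H [::]; split => // i; apply: IH => a.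
by rewrite -partials_rcons.
Qed.

Lemma regularD n (P : set ('rV[R]_n -> R)) :
  (forall f g, P f -> P g -> P (fun x => f x + g x)) ->
  forall k f g, regular P k f -> regular P k g ->
  regular P k (fun x => f x + g x).
Proof.
move=> PD; elim=> [|k IH] f g [df Pf Hf] [dg Pg Hg].
  by split=> [x||//]; [exact: differentiableD|exact: PD].
split=> [x||i]; [exact: differentiableD|exact: PD|].
by rewrite partialD//; apply: IH; [exact: Hf|exact: Hg].
Qed.

Lemma regular_cst n (P : set ('rV[R]_n -> R)) :
  (forall c, P (fun=> c)) -> forall k c, regular P k (fun=> c).
Proof.
move=> Pc; elim=> [|k IH] c; split => // i.
by rewrite partial_cst.
Qed.

(** Two growth conditions are kept apart so that a factor with bounded derivatives may multiply a
    rapidly decaying one; [Q = P] gives closure of a class under products. *)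
Lemma regularM n (Q P : set ('rV[R]_n -> R)) :
  (forall f g, P f -> P g -> P (fun x => f x + g x)) ->
  (forall f g, Q f -> P g -> P (fun x => f x * g x)) ->
  forall k f g, regular Q k f -> regular P k g ->
  regular P k (fun x => f x * g x).
Proof.
move=> PD QM; elim=> [|k IH] f g rf rg.
  have [df Qf Hf] := rf; have [dg Pg Hg] := rg.
  by split=> [x||//]; [exact: differentiableM|exact: QM].
have [df Qf Hf] := rf; have [dg Pg Hg] := rg.
split=> [x||i]; [exact: differentiableM|exact: QM|].
rewrite partialM//; apply: regularD => //; apply: IH.
- exact: regularS.
- exact: Hg.
- exact: Hf.
- exact: regularS.
Qed.

Lemma regular_sum n (P : set ('rV[R]_n -> R)) :
  (forall f g, P f -> P g -> P (fun x => f x + g x)) -> P (fun=> 0) ->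
  forall k m (F : 'I_m -> 'rV[R]_n -> R), (forall j, regular P k (F j)) ->
  regular P k (fun x => \sum_j F j x).
Proof.
move=> PD P0 k; elim=> [|m IH] F HF.
  rewrite (_ : (fun x => _) = fun=> 0); last first.
    by apply/funext => x; rewrite big_ord0.
  elim: k {HF} => [|k IH]; split => // i; rewrite partial_cst; exact: IH.
rewrite (_ : (fun x => _) = fun x => F ord0 x + \sum_j F (lift ord0 j) x).
  by apply: regularD => //; apply: IH.
by apply/funext => x; rewrite big_ord_recl.
Qed.

(** The chain rule only ever produces derivatives of [h] as factors, so [Q] is asked of the first
    partial derivatives and [h] itself may grow, as canonical transformations and translations
    do. *)
Lemma regular_comp n m (P' : set ('rV[R]_m -> R)) (P Q : set ('rV[R]_n -> R))
    (h : 'rV[R]_n -> 'rV[R]_m) :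
  (forall f g, P f -> P g -> P (fun x => f x + g x)) -> P (fun=> 0) ->
  (forall f g, Q f -> P g -> P (fun x => f x * g x)) ->
  (forall f, P' f -> P (f \o h)) ->
  (forall x, differentiable h x) ->
  (forall k i j, regular Q k (partial i (fun z => h z ord0 j))) ->
  forall k f, regular P' k f -> regular P k (f \o h).
Proof.
move=> PD P0 QM Ph dh rh; elim=> [|k IH] f [df Pf Hf].
  by split=> [x||//]; [exact: differentiable_comp|exact: Ph].
split=> [x||i]; [exact: differentiable_comp|exact: Ph|].
rewrite partial_comp//; apply: regular_sum => // j.
rewrite (_ : (fun x => _) = (fun x => partial i (fun z => h z ord0 j) x *
  (partial j f \o h) x)); last by apply/funext => x; rewrite mulrC.
by apply: (regularM PD QM) => //; apply: IH; exact: Hf.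
Qed.

Definition bounded_fct n (f : 'rV[R]_n -> R) : Prop :=
  exists M, forall x, `|f x| <= M.

Lemma bounded_fctD n (f g : 'rV[R]_n -> R) :
  bounded_fct f -> bounded_fct g -> bounded_fct (fun x => f x + g x).
Proof.
move=> [M HM] [N HN]; exists (M + N) => x.
by rewrite (le_trans (ler_normD _ _))// lerD.
Qed.

Lemma bounded_fctM n (f g : 'rV[R]_n -> R) :
  bounded_fct f -> bounded_fct g -> bounded_fct (fun x => f x * g x).
Proof.
by move=> [M HM] [N HN]; exists (M * N) => x; rewrite normrM ler_pM.
Qed.

Lemma bounded_fct_cst n (c : R) : bounded_fct (fun _ : 'rV[R]_n => c).
Proof. by exists `|c|. Qed.

End partial_derivatives.

(** * Norms, mean value inequality and smooth maps *)

Lemma le_mx_norm (R : realType) m n (A : 'M[R]_(m, n)) i j : `|A i j| <= `|A|.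
Proof.
rewrite [leRHS]/Num.norm/= mx_normrE.
exact: (le_bigmax _ (fun ij : 'I_m * 'I_n => `|A ij.1 ij.2|) (i, j)).
Qed.

Section euclidean_norm.
Context {R : realType} (n : nat).
Implicit Types u v : 'rV[R]_n.

Lemma le_coord_norm v i : `|v ord0 i| <= `|v|.
Proof. exact: le_mx_norm. Qed.

Lemma norm_rV_le v c : 0 <= c -> (forall i, `|v ord0 i| <= c) -> `|v| <= c.
Proof.
move=> c0 H; rewrite [leLHS]/Num.norm/= mx_normrE; apply: bigmax_le => //=.
by move=> [i j] _ /=; rewrite (ord1 i).
Qed.

Lemma dot_ge0 v : 0 <= dot v v.
Proof. by apply: sumr_ge0 => i _; rewrite -expr2 sqr_ge0. Qed.

Lemma enorm_ge0 v : 0 <= enorm v.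
Proof. exact: sqrtr_ge0. Qed.

Lemma le_coord_enorm v i : `|v ord0 i| <= enorm v.
Proof.
rewrite -sqrtr_sqr ler_sqrt ?dot_ge0// expr2 /dot (bigD1 i)//= lerDl.
by apply: sumr_ge0 => j _; rewrite -expr2 sqr_ge0.
Qed.

Lemma norm_le_enorm v : `|v| <= enorm v.
Proof. by apply: norm_rV_le => [|i]; [exact: enorm_ge0|exact: le_coord_enorm]. Qed.

Lemma enorm_le_norm v : enorm v <= n%:R * `|v|.
Proof.
have nv0 : 0 <= n%:R * `|v| by rewrite mulr_ge0.
rewrite -(ger0_norm nv0) -sqrtr_sqr ler_sqrt ?sqr_ge0//.
rewrite (@le_trans _ _ (\sum_(i < n) `|v| ^+ 2))//.
  apply: ler_sum => i _; rewrite -expr2 -real_normK ?num_real//.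
  by rewrite lerXn2r ?nnegrE// le_coord_norm.
rewrite sumr_const card_ord -[leLHS]mulr_natl exprMn ler_wpM2r ?sqr_ge0//.
by rewrite -natrX ler_nat; case: (n) => // m; rewrite leq_pmulr.
Qed.

Lemma japanese_le v : japanese v <= n.+1%:R * (1 + `|v|).
Proof.
have h0 : 0 <= 1 + `|v| by rewrite addr_ge0.
have h : 0 <= n.+1%:R * (1 + `|v|) by rewrite mulr_ge0.
have H : 1 + enorm v <= n.+1%:R * (1 + `|v|).
  rewrite -natr1 mulrDl mul1r mulrDr mulr1.
  have := enorm_le_norm v; have : 0 <= n%:R :> R by [].
  by have := normr_ge0 v; lra.
rewrite (le_trans _ H)// -[leRHS]ger0_norm ?addr_ge0 ?enorm_ge0//.
rewrite -sqrtr_sqr ler_sqrt ?sqr_ge0//.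
by have := enorm_ge0 v; rewrite sqrrD; lra.
Qed.

Lemma le_japanese v : 1 + `|v| <= 2 * japanese v.
Proof.
have -> : 2 * japanese v = japanese v + japanese v by ring.
have e0 := enorm_ge0 v; apply: lerD.
  by rewrite -[leLHS]sqrtr1 ler_sqrt ?lerDl ?sqr_ge0// addr_ge0 ?sqr_ge0.
rewrite (le_trans (norm_le_enorm v))// -[leLHS]ger0_norm// -sqrtr_sqr.
by rewrite ler_sqrt ?lerDr// addr_ge0// sqr_ge0.
Qed.

Lemma japanese_gt0 v : 0 < japanese v.
Proof. by rewrite sqrtr_gt0 ltr_wpDr// sqr_ge0. Qed.

End euclidean_norm.

Section mean_value.
Context {R : realType} (n : nat).

(** The mean value theorem for [f] along the segment. The bound is asked for on the segment only, so
    that the lemma can be used inside a ball; the factor [n] comes from summing [n] partial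
    derivatives against the sup norm. *)
Lemma lipschitz_of_partial (f : 'rV[R]_n -> R) (C : R) (x y : 'rV[R]_n) :
  (forall z, differentiable f z) ->
  (forall t i, 0 <= t <= 1 -> `|partial i f (x + t *: (y - x))| <= C) ->
  `|f y - f x| <= n%:R * C * `|y - x|.
Proof.
move=> df HC.
pose l (t : R) : 'rV[R]_n := x + t *: (y - x).
have dl (t : R) : is_diff t l (fun h => h *: (y - x)).
  rewrite /l; have -> : (fun h : R => h *: (y - x)) = 0 + ( *:%R^~ (y - x)).
    by apply/funext => h /=; rewrite add0r.
  exact: is_diffD.
have dlt (t : R) : differentiable l t by have [] := dl t.
have dlE (t : R) : 'd l t = (fun h => h *: (y - x)) :> (_ -> _) by have [] := dl t.
have dfl (t : R) : is_derive t (1 : R) (f \o l) ('D_(y - x) f (l t)).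
  have dflt : differentiable (f \o l) t by exact: differentiable_comp.
  apply: DeriveDef; first exact: diff_derivable.
  by rewrite !deriveE// diff_comp//= dlE scale1r.
have [|t t01 E] := @MVT_segment R (f \o l) _ 0 1 ler01 (fun t _ => dfl t).
  apply: continuous_subspaceT => t; apply: differentiable_continuous.
  exact: differentiable_comp.
move: E; rewrite /= /l scale1r scale0r addr0 subr0 mulr1 (addrC x) subrK => ->.
rewrite deriveE// [X in 'd f _ X]row_sum_delta linear_sum.
rewrite (le_trans (ler_norm_sum _ _ _))// -mulrA.
rewrite (@le_trans _ _ (\sum_(i < n) (C * `|y - x|)))//; last first.
  by rewrite sumr_const card_ord -[leLHS]mulr_natl.
apply: ler_sum => i _; rewrite linearZ/= -deriveE// normrM mulrC.
by apply: ler_pM => //; [exact: HC|exact: le_coord_norm].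
Qed.

End mean_value.

Section smooth_maps.
Context {R : realType}.

Lemma partials_row n m (f : 'rV[R]_n -> 'rV[R]_m) a j : smooth f ->
  (fun z => partials a f z ord0 j) = partials a (fun z => f z ord0 j).
Proof.
move=> sf; elim: a => [//|i a IH]; apply/funext => z /=.
by rewrite -/(partial i (partials a f) z) (partial_row _ _ (sf a z)) IH.
Qed.

Lemma smooth_diff n (V : normedModType R) (f : 'rV[R]_n -> V) x :
  smooth f -> differentiable f x.
Proof. by move=> /(_ [::] x). Qed.

Lemma smooth_of_coord n m (f : 'rV[R]_n -> 'rV[R]_m) :
  (forall a j x, differentiable (partials a (fun z => f z ord0 j)) x) ->
  smooth f.
Proof.
move=> df.
(* Exchanging a coordinate with a partial derivative requires the vector-valued map to be
   differentiable, so both claims go through one induction. *)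
suff H a : (forall x, differentiable (partials a f) x) /\
    forall j, (fun z => partials a f z ord0 j) = partials a (fun z => f z ord0 j).
  by move=> a x; have [] := H a.
elim: a => [|i a [dfa IH]].
  by split=> // x; apply: differentiable_row => j; exact: (df [::]).
have E j : (fun z => partials (i :: a) f z ord0 j) =
    partials (i :: a) (fun z => f z ord0 j).
  apply/funext => z /=.
  by rewrite -/(partial i (partials a f) z) (partial_row _ _ (dfa z)) IH.
by split => // x; apply: differentiable_row => j; rewrite E.
Qed.

(** B2 starts at order one and leaves the map itself free to be unbounded; [regular] is therefore
    stated for the first partial derivatives of the coordinates, in the form that [regular_comp]
    consumes. *)
Lemma smooth_B2P n m (f : 'rV[R]_n -> 'rV[R]_m) :
  smooth f /\ (forall a : seq 'I_n, (1 <= size a)%N ->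
    exists C : R, forall z, enorm (partials a f z) <= C) <->
  (forall x, differentiable f x) /\
  forall k i j, regular (@bounded_fct R n) k (partial i (fun z => f z ord0 j)).
Proof.
split=> [[sf bf]|[df rf]].
  split=> [x|k i j]; first exact: smooth_diff.
  move: k; apply/regularP => a; rewrite -partials_rcons -partials_row//.
  split=> [x|]; first exact/differentiable_coord_comp/sf.
  have [|C HC] := bf (rcons a i); first by rewrite size_rcons.
  by exists C => x; rewrite (le_trans (le_coord_enorm _ _)).
have H a j : (forall x, differentiable (partials a (fun z => f z ord0 j)) x) /\
    ((1 <= size a)%N -> bounded_fct (partials a (fun z => f z ord0 j))).
  case/lastP: a => [|a i].
    by split => // x; exact: differentiable_coord_comp.
  rewrite partials_rcons.
  by have /regularP/(_ a)[? ?] := fun k => rf k i j.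
have sf : smooth f.
  by apply: smooth_of_coord => a' j; exact: (H a' j).1.
split => // a a0; have C j : {C | forall x, `|partials a f x ord0 j| <= C}.
  apply: cid; have [C HC] := (H a j).2 a0; exists C => x.
  by rewrite -[partials a f x ord0 j]/((fun z => partials a f z ord0 j) x) partials_row.
exists (m%:R * \sum_j sval (C j)) => z; rewrite (le_trans (enorm_le_norm _))//.
have C0 j : 0 <= sval (C j) by case: (C j) => c /= /(_ z); exact: le_trans.
rewrite ler_wpM2l//; apply: norm_rV_le => [|i]; first exact: sumr_ge0.
rewrite (bigD1 i)//= (le_trans (svalP (C i) z))// lerDl.
exact: sumr_ge0.
Qed.

End smooth_maps.

(** * Canonical transformations *)

(* The library makes row vectors a complete space and a normed module, but does
   not declare the join of the two structures. *)
HB.instance Definition _ (R : realType) n := Complete.on 'rV[R]_n.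

Section canonical_composition.
Context {R : realType} (d : nat).
Local Notation phase := 'rV[R]_(d + d).
Implicit Types chi : phase -> phase.

Lemma condB_comp chi1 chi2 : condB1 chi1 -> condB2 chi1 ->
  condB1 chi2 -> condB2 chi2 ->
  condB1 (chi1 \o chi2) /\ condB2 (chi1 \o chi2).
Proof.
move=> [s1 bij1 sy1] b1 [s2 bij2 sy2] b2.
have [d1 r1] := (smooth_B2P chi1).1 (conj s1 b1).
have [d2 r2] := (smooth_B2P chi2).1 (conj s2 b2).
suff [s12 b12] : smooth (chi1 \o chi2) /\ condB2 (chi1 \o chi2).
  split; last exact: b12.
  split; [exact: s12|exact: bij_comp|move=> z u v].
  by rewrite diff_comp; [rewrite /= sy1 sy2|exact: d2|exact: d1].
apply/smooth_B2P; split=> [x|k i j]; first exact: differentiable_comp.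
have -> : (fun z => (chi1 \o chi2) z ord0 j) = (fun z => chi1 z ord0 j) \o chi2.
  by [].
rewrite partial_comp; last 2 first.
- by move=> x; exact: differentiable_coord_comp.
- exact: d2.

apply: regular_sum => [f g| |l]; first exact: bounded_fctD.
  exact: bounded_fct_cst.
apply: (@regularM _ _ (@bounded_fct _ _)) => [f g|f g||].
- exact: bounded_fctD.
- exact: bounded_fctM.
- apply: (@regular_comp _ _ _ (@bounded_fct _ _) _ (@bounded_fct _ _)) => //.
  + exact: bounded_fctD.
  + exact: bounded_fct_cst.
  + exact: bounded_fctM.
  + by move=> f [M HM]; exists M => x; exact: HM.
- exact: r2.
Qed.

End canonical_composition.

(** * Uniform local surjectivity from bounds on derivatives *)

Section distortion.
Context {R : realType}.

Lemma is_diff_shift n (z x : 'rV[R]_n) : is_diff x (fun h : 'rV[R]_n => z + h) id.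
Proof.
rewrite [X in is_diff _ _ X](_ : id = 0 + id); last by apply/funext => u; rewrite /= add0r.
exact: is_diffD.
Qed.

Lemma differentiable_shift n (z x : 'rV[R]_n) :
  differentiable (fun h : 'rV[R]_n => z + h) x.
Proof. by have [] := is_diff_shift z x. Qed.

Lemma partial_shift n k (z x : 'rV[R]_n) (g : 'rV[R]_n -> R) :
  (forall u, differentiable g u) ->
  partial k (fun h => g (z + h)) x = partial k g (z + x).
Proof.
move=> dg; have dz := differentiable_shift z x.
have dgz : differentiable (g \o (fun h => z + h)) x.
  exact: differentiable_comp dz (dg _).
apply: (etrans (deriveE (delta_mx ord0 k) dgz)).
apply: (etrans _ (esym (deriveE (delta_mx ord0 k) (dg (z + x))))).
apply: (etrans (congr1 (fun l : 'rV[R]_n -> R => l (delta_mx ord0 k))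
  (diff_comp dz (dg (z + x))))).
rewrite [LHS]/comp; congr ('d g _ _).
have [_ E] := is_diff_shift z x.
exact: (congr1 (fun l : 'rV[R]_n -> 'rV[R]_n => l (delta_mx ord0 k)) E).
Qed.

Lemma partial_coord n k j (x : 'rV[R]_n) :
  partial k (fun h => h ord0 j) x = (k == j)%:R.
Proof.
have did : differentiable (@id 'rV[R]_n) x by have [] := is_diff_id x.
rewrite -(partial_row k j did).
by rewrite /partial derive_id mxE eqxx/= eq_sym.
Qed.

Lemma norm_mulmx_coord m n p (A : 'M[R]_(m, n)) (B : 'M[R]_(n, p)) a b i j :
  (forall i j, `|A i j| <= a) -> (forall i j, `|B i j| <= b) ->
  `|(A *m B) i j| <= n%:R * (a * b).
Proof.
move=> Aa Bb; rewrite mxE (le_trans (ler_norm_sum _ _ _))//.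
rewrite (@le_trans _ _ (\sum_(k < n) (a * b)))//.
  by apply: ler_sum => k _; rewrite normrM ler_pM.
by rewrite sumr_const card_ord -[leLHS]mulr_natl.
Qed.

(* A quantitative local inversion: the two-sided uniform bounds on the
   derivative make [h |-> h - (f (z + h) - w) *m K] a contraction of a ball whose
   radius does not depend on [z]. *)
Lemma uniform_local_surjection n (f : 'rV[R]_n -> 'rV[R]_n)
    (K : 'rV[R]_n -> 'M[R]_n) (C2 CK : R) :
  (forall x, differentiable f x) ->
  (forall i j x, differentiable (partial i (fun z => f z ord0 j)) x) ->
  (forall k i j x, `|partial k (partial i (fun z => f z ord0 j)) x| <= C2) ->
  (forall z i j, `|K z i j| <= CK) ->
  (forall z, (\matrix_(i, j) partial i (fun z => f z ord0 j) z) *m K z = 1%:M) ->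
  exists r r' : R, [/\ 0 < r, 0 < r' & forall z w, `|w - f z| <= r' ->
    exists2 z', `|z' - z| <= r & f z' = w].
Proof.
move=> df d2f HC2 HCK MK.
(* In dimension 0 there is no index from which to read off that [C2] and [CK] are nonnegative. *)
have [n0|n_gt0] := posnP n.
  exists 1, 1; split => // z w _; exists z; first by rewrite subrr normr0.
  by apply/rowP => i; have := ltn_ord i; rewrite [X in (_ < X)%N]n0.
have i0 : 'I_n by exact: (Ordinal n_gt0).
have C20 : 0 <= C2 by rewrite (le_trans _ (HC2 i0 i0 i0 0)).
have CK0 : 0 <= CK by rewrite (le_trans _ (HCK 0 i0 i0)).
(* On the ball of radius [r] the contraction has Lipschitz constant [D * r], which the choice of [r]
   makes at most one half. The three factors [n] come from the mean value inequality for the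
   contraction, the matrix product with [K], and the mean value inequality for the derivative of
   [f]. *)
pose D := n%:R * (n%:R * (n%:R * C2 * CK)).
have D0 : 0 <= D by rewrite /D !mulr_ge0.
pose r := (2 * (D + 1))^-1; have r0 : 0 < r by rewrite invr_gt0 mulr_gt0 ?ltr_wpDl.
have Dr : D * r <= 2^-1.
  by rewrite /r invfM mulrCA ler_piMr// ler_pdivrMr ?ltr_wpDl// mul1r lerDl.
(* [r'] is chosen so that the image of 0, which is [(w - f z) *m K z], has norm at most [r / 2]. *)
pose E := n%:R * CK + 1; have E0 : 0 < E by rewrite ltr_wpDl// mulr_ge0.
pose r' := r / (2 * E); have r'0 : 0 < r' by rewrite divr_gt0// mulr_gt0.
exists r, r'; split => // z w Hw.
pose F (j : 'I_n) (h : 'rV[R]_n) : R :=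
  h ord0 j - \sum_i (f (z + h) ord0 i - w ord0 i) * K z i j.
pose phi (h : 'rV[R]_n) : 'rV[R]_n := h - (f (z + h) - w) *m K z.
have phiE h j : phi h ord0 j = F j h.
  rewrite /phi /F mxE; congr (_ + _); rewrite mxE mxE; congr (- _).
  by apply: eq_bigr => i _; rewrite !mxE.
have dfi i x : differentiable (fun h => f (z + h) ord0 i) x.
  apply: (@differentiable_comp _ _ _ _ (fun h => z + h) (fun u => f u ord0 i)).
    exact: differentiable_shift.
  exact: differentiable_coord_comp.
have dfw i x : differentiable (fun h => f (z + h) ord0 i - w ord0 i) x.
  by apply: differentiableB; [exact: dfi|exact: differentiable_cst].
have dfK i j x : differentiable (fun h => (f (z + h) ord0 i - w ord0 i) * K z i j) x.
  by apply: differentiableM; [exact: dfw|exact: differentiable_cst].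
have F_sum j : F j = (fun h : 'rV[R]_n => h ord0 j : R) -
    \sum_i (fun h : 'rV[R]_n => (f (z + h) ord0 i - w ord0 i) * K z i j : R).
  by apply/funext => h; rewrite /F/= fct_sumE.
have dF j x : differentiable (F j) x.
  rewrite F_sum; apply: differentiableB; first exact: differentiable_coord.
  exact: differentiable_sum.
(* Writing the identity matrix as the derivative at [z] times [K z] leaves only the variation of the
   derivative between [z] and [z + x], which the second derivatives control. *)
have pF k j x : partial k (F j) x =
    \sum_i (partial k (fun u => f u ord0 i) z -
            partial k (fun u => f u ord0 i) (z + x)) * K z i j.
  have -> : partial k (F j) x = (k == j)%:R -
      \sum_i partial k (fun u => f u ord0 i) (z + x) * K z i j.
    rewrite /partial F_sum deriveB; last 2 first.
    - exact/diff_derivable/differentiable_coord.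
    - exact/diff_derivable/differentiable_sum.
    congr (_ - _); first exact: partial_coord.
    rewrite derive_sum; last by move=> i; exact: diff_derivable.
    apply: eq_bigr => i _.
    apply: (etrans (congr1 (@^~ x) (partialM k (dfw i) (fun u => differentiable_cst _ u)))).
    rewrite /= partial_cst mulr0 add0r.
    congr (_ * _).
    apply: (etrans (congr1 (@^~ x) (partialD k (dfi i) (fun u => differentiable_cst _ u)))).
    rewrite /= partial_cst addr0.
    exact: partial_shift k _ _ _ (fun u => differentiable_coord_comp _ (df u)).
  under [RHS]eq_bigr do rewrite mulrBl.
  rewrite sumrB; congr (_ - _); have /matrixP/(_ k j) := MK z.
  by rewrite !mxE => <-; apply: eq_bigr => i _; rewrite mxE.
have pF_le k j x : `|x| <= r -> `|partial k (F j) x| <= n%:R * (n%:R * C2 * r * CK).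
  move=> xr; rewrite pF (le_trans (ler_norm_sum _ _ _))//.
  rewrite (@le_trans _ _ (\sum_(i < n) (n%:R * C2 * r * CK)))//; last first.
    by rewrite sumr_const card_ord -[leLHS]mulr_natl.
  apply: ler_sum => i _; rewrite normrM ler_pM// distrC.
  apply: (@le_trans _ _ (n%:R * C2 * `|z + x - z|)); last first.
    by rewrite ler_wpM2l ?mulr_ge0// addrC addKr.
  by apply: lipschitz_of_partial => // t k' _; exact: HC2.
have phi_lip x y : `|x| <= r -> `|y| <= r -> `|phi y - phi x| <= 2^-1 * `|y - x|.
  move=> xr yr; apply: norm_rV_le => [|j]; first by rewrite mulr_ge0 ?invr_ge0.
  rewrite mxE [(- phi x) _ _]mxE !phiE.
  apply: (@le_trans _ _ (n%:R * (n%:R * (n%:R * C2 * r * CK)) * `|y - x|)); last first.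
    by rewrite ler_wpM2r//; move: Dr; rewrite /D; congr (_ <= _); ring.
  apply: lipschitz_of_partial => // t k /andP[t0 t1]; apply: pF_le.
  have -> : x + t *: (y - x) = (1 - t) *: x + t *: y.
    by rewrite scalerBr scalerBl scale1r addrCA addrC.
  rewrite (le_trans (ler_normD _ _))// !normrZ !ger0_norm ?subr_ge0//.
  have -> : r = (1 - t) * r + t * r by ring.
  by rewrite lerD// ler_wpM2l// subr_ge0.
pose U := [set h : 'rV[R]_n | `|h| <= r].
have phi0 : `|phi 0| <= r / 2.
  rewrite /phi sub0r normrN addr0; apply: norm_rV_le => [|j]; first by rewrite divr_ge0 ?ltW.
  rewrite (@le_trans _ _ (n%:R * (r' * CK)))//.
    apply: norm_mulmx_coord => // i j'; rewrite (ord1 i) (le_trans (le_coord_norm _ _))//.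
    by rewrite distrC.
  rewrite /r' mulrCA mulrAC -mulrA ler_wpM2l ?(ltW r0)//.
  rewrite invfM mulrC -mulrA ler_piMr ?invr_ge0//.
  by rewrite mulrC ler_pdivrMr// mul1r lerDl.
(* One half of the radius is spent on [phi 0], the other on the contraction. *)
have phiU : {homo phi : x / U x >-> U x}.
  move=> x /= xr.
  rewrite /U/= -[phi x](subrK (phi 0)).
  rewrite (le_trans (ler_normD _ _))//.
  have := phi_lip 0 x; rewrite normr0 subr0 => /(_ (ltW r0) xr) h.
  rewrite (_ : r = 2^-1 * r + r / 2); last by field.
  by rewrite lerD// (le_trans h)// ler_wpM2l.
pose g : {fun U >-> U} := mkfun_fun phiU.
have [] := @banach_fixed_point R 'rV[R]_n U g.
- exists (2^-1)%:nng; split => /=; first by rewrite invf_lt1 ?ltr1n.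
  by move=> -[x y] [/= xU yU]; apply: phi_lip.
- rewrite (_ : U = closed_ball_ Num.norm 0 r); first exact: closed_closed_ball_.
  by apply/seteqP; split => h /=; rewrite /closed_ball_/= sub0r normrN.
- by exists 0; rewrite /U/= normr0 ltW.
move=> h hU hE; exists (z + h); first by rewrite addrC addKr.
have : (f (z + h) - w) *m K z = 0.
  move: hE; rewrite /g/= /mkfun /phi => /eqP.
  by rewrite -subr_eq0 opprB addrCA subrr addr0 => /eqP.
move/(congr1 (mulmxr (\matrix_(i, j) partial i (fun z => f z ord0 j) z))).
by rewrite /= mul0mx -mulmxA (mulmx1C (MK z)) mulmx1 => /eqP; rewrite subr_eq0 => /eqP.
Qed.

End distortion.

(** * Large-scale bi-Lipschitz bounds for canonical transformations *)

Section canonical_distortion.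
Context {R : realType} (d : nat).
Local Notation phase := 'rV[R]_(d + d).

Definition symp_mx : 'M[R]_(d + d) := block_mx 0 1%:M (- 1%:M) 0.

Lemma dotE n (u v : 'rV[R]_n) : dot u v = (u *m v^T) ord0 ord0.
Proof. by rewrite mxE; apply: eq_bigr => i _; rewrite mxE. Qed.

Lemma sympE (u v : phase) : symp u v = (u *m symp_mx *m v^T) ord0 ord0.
Proof.
rewrite /symp /symp_mx -{3}(hsubmxK u) -{3}(hsubmxK v) mul_row_block.
rewrite !mulmx0 mulmxN !mulmx1 addr0 add0r tr_row_mx mul_row_col mulNmx.
by rewrite [RHS]mxE [in RHS]mxE -!dotE addrC.
Qed.

Lemma symp_mxK : symp_mx *m symp_mx^T = 1%:M.
Proof.
rewrite /symp_mx tr_block_mx mulmx_block !trmx0 !mulmx0 !mul0mx.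
rewrite linearN/= trmx1 mulNmx mulmxN opprK !mulmx1 !addr0 add0r.
by rewrite -scalar_mx_block.
Qed.

(** On row vectors the differential acts by right multiplication, so its matrix is the transpose of
    the usual Jacobian. *)
Lemma diff_rVE n m (f : 'rV[R]_n -> 'rV[R]_m) z u : differentiable f z ->
  'd f z u = u *m \matrix_(i, j) partial i (fun x => f x ord0 j) z.
Proof.
move=> df; rewrite [X in 'd f _ X]row_sum_delta linear_sum.
apply/rowP => j; rewrite summxE mxE; apply: eq_bigr => i _.
rewrite linearZ !mxE; congr (_ * _).
apply: (etrans _ (partial_row i j df)).
by rewrite /partial (deriveE _ df).
Qed.

(* [M Omega M^T = Omega] inverts [M] explicitly, so that a bound on [M] is also
   a bound on its inverse. *)
Lemma symplectic_inverse (chi : phase -> phase) z : condB1 chi ->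
  let M := \matrix_(i, j) partial i (fun x => chi x ord0 j) z in
  M *m (symp_mx *m M^T *m symp_mx^T) = 1%:M.
Proof.
move=> [s _ sy] M; rewrite !mulmxA.
suff -> : M *m symp_mx *m M^T = symp_mx by exact: symp_mxK.
apply/matrixP => i j.
have := sy z (delta_mx ord0 i) (delta_mx ord0 j).
rewrite !sympE !(diff_rVE _ (smooth_diff z s)) -/M trmx_mul !mulmxA.
rewrite -(mulmxA (delta_mx ord0 i)) -(mulmxA (delta_mx ord0 i) _ M^T).
by rewrite trmx_delta -!rowE -!colE !mxE.
Qed.

Lemma le_sumr_term (I : finType) (F : I -> R) i :
  (forall j, 0 <= F j) -> F i <= \sum_j F j.
Proof. by move=> F0; rewrite (bigD1 i)//= lerDl; exact: sumr_ge0. Qed.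

(* Lifting the segment from [chi b] to [chi a] in steps of fixed length, by
   [uniform_local_surjection], replaces the Lipschitz continuity of the inverse
   of [chi]. *)
Lemma condB_distortion (chi : phase -> phase) : condB1 chi -> condB2 chi ->
  exists2 C : R, 0 < C & forall a b,
    1 + `|chi a - chi b| <= C * (1 + `|a - b|) /\
    1 + `|a - b| <= C * (1 + `|chi a - chi b|).
Proof.
move=> B1 B2; have [s bij _] := B1.
have [df rf] := (smooth_B2P chi).1 (conj s B2).
pose p i j := partial i (fun x => chi x ord0 j).
have dp i j x : differentiable (p i j) x by apply: (regular_diff (rf 0%N i j)).
have bd1 i j : {C : R | forall x, `|p i j x| <= C}.
  by apply: cid; exact: (regular_in (rf 0%N i j)).
have bd2 k i j : {C : R | forall x, `|partial k (p i j) x| <= C}.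
  by apply: cid; have [_ _ /(_ k) []] := rf 1%N i j.
pose C1 := \sum_i \sum_j sval (bd1 i j).
pose C2 := \sum_k \sum_i \sum_j sval (bd2 k i j).
have bd1_ge0 i j : 0 <= sval (bd1 i j).
  by case: (bd1 i j) => c /= /(_ 0); exact: le_trans.
have bd2_ge0 k i j : 0 <= sval (bd2 k i j).
  by case: (bd2 k i j) => c /= /(_ 0); exact: le_trans.
have C1P i j x : `|p i j x| <= C1.
  apply: (le_trans (svalP (bd1 i j) x)).
  apply: (le_trans (le_sumr_term j (fun j => bd1_ge0 i j))).
  apply: (@le_sumr_term _ (fun i => \sum_j sval (bd1 i j))) => i'.
  by apply: sumr_ge0 => j' _; exact: bd1_ge0.
have C2P k i j x : `|partial k (p i j) x| <= C2.
  apply: (le_trans (svalP (bd2 k i j) x)).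
  apply: (le_trans (le_sumr_term j (fun j => bd2_ge0 k i j))).
  have H k' i' : 0 <= \sum_j sval (bd2 k' i' j).
    by apply: sumr_ge0 => j' _; exact: bd2_ge0.
  apply: (le_trans (@le_sumr_term _ (fun i => \sum_j sval (bd2 k i j)) i (H k))).
  apply: (@le_sumr_term _ (fun k => \sum_i \sum_j sval (bd2 k i j))) => k'.
  by apply: sumr_ge0 => i' _; exact: H.
pose n := (d + d)%N.
pose M z : 'M[R]_(d + d) := \matrix_(i, j) p i j z.
have MC1 z i j : `|(M z)^T i j| <= C1 by rewrite !mxE.
have HK z i j : `|(symp_mx *m (M z)^T *m symp_mx^T) i j| <=
    n%:R * (n%:R * (`|symp_mx| * C1) * `|symp_mx^T|).
  apply: norm_mulmx_coord => [i' k|]; last exact: le_mx_norm.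
  by apply: norm_mulmx_coord; [exact: le_mx_norm|exact: MC1].
have [r [r' [r0 r'0 Hloc]]] := uniform_local_surjection df dp C2P HK
  (fun z => symplectic_inverse z B1).
have chain m a w : `|w - chi a| <= m%:R * r' ->
    exists2 b, `|b - a| <= m%:R * r & chi b = w.
  elim: m w => [|m IH] w.
    rewrite mul0r normr_le0 subr_eq0 => /eqP ->.
    by exists a => //; rewrite subrr normr0 mul0r.
  (* [w'] lies at the fraction [m / (m + 1)] of the segment: the induction hypothesis reaches it in
     [m] steps, and the remaining piece has length at most [r']. *)
  move=> H; pose w' := chi a + (m%:R / m.+1%:R) *: (w - chi a).
  have [|b' b'a b'w] := IH w'.
    rewrite /w' addrC addKr normrZ ger0_norm ?divr_ge0//.
    by rewrite mulrAC ler_pdivrMr// -!mulrA ler_wpM2l// mulrC.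
  have [|b bb' bw] := Hloc b' w.
    rewrite b'w /w' opprD addrA -{1}[w - chi a]scale1r -scalerBl.
    rewrite normrZ ger0_norm; last by rewrite subr_ge0 ler_pdivrMr// mul1r ler_nat.
    have -> : 1 - m%:R / m.+1%:R = m.+1%:R^-1 :> R.
      rewrite -[X in X - _](@divff _ (m.+1%:R : R)) ?pnatr_eq0//.
      by rewrite -mulrBl -natrB// subSnn mul1r.
    by rewrite mulrC ler_pdivrMr// mulrC.
  exists b => //; rewrite -(subrK b' b) -addrA (le_trans (ler_normD _ _))//.
  by rewrite -natr1 mulrDl mul1r [leRHS]addrC lerD.
(* [n * C1] is the Lipschitz constant of [chi]; [r + r / r'] pays for the lift, whose at most
   [|chi a - chi b| / r' + 1] steps have length at most [r] each. *)
pose C := 1 + n%:R * C1 + (r + r / r').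
have C10 : 0 <= C1.
  by apply: sumr_ge0 => i _; apply: sumr_ge0 => j _; exact: bd1_ge0.
have nC1 : 0 <= n%:R * C1 by rewrite mulr_ge0.
have rr : 0 < r + r / r' by rewrite addr_gt0// divr_gt0.
exists C => [|a b]; first by rewrite addr_gt0// ltr_pwDl.
split.
  have H : `|chi a - chi b| <= n%:R * C1 * `|a - b|.
    apply: norm_rV_le => [|i]; first by rewrite mulr_ge0.
    rewrite !mxE; apply: (@lipschitz_of_partial R _ (fun z => chi z ord0 i) C1 b a).
      by move=> z; exact: differentiable_coord_comp.
    by move=> t k _; exact: C1P.
  rewrite /C; have := normr_ge0 (a - b); nra.
pose q := `|chi a - chi b| / r'; pose m := (Num.truncn q).+1.
have /andP[mle /ltW mE] : (Num.truncn q)%:R <= q < m%:R.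
  by apply: Num.Theory.truncn_itv; rewrite divr_ge0// ltW.
have {}mle : m%:R <= q + 1 by rewrite -natr1 lerD2r.
have [|c ca cw] := chain m b (chi a); first by rewrite -ler_pdivrMr.
(* The lift ends at some preimage of [chi a]; injectivity identifies it with [a]. *)
have -> : a = c by apply: (bij_inj bij).
have H : `|c - b| <= (`|chi a - chi b| / r' + 1) * r.
  by rewrite (le_trans ca)// ler_wpM2r// ltW.
rewrite cw.
have -> : C * (1 + `|chi a - chi b|) = (1 + n%:R * C1) * (1 + `|chi a - chi b|) +
   (r + r / r' + (r * `|chi a - chi b| + `|chi a - chi b| / r' * r)) by rewrite /C; ring.
have x0 := normr_ge0 (chi a - chi b).
have : 0 <= n%:R * C1 * (1 + `|chi a - chi b|) by rewrite mulr_ge0// addr_ge0.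
have : 0 <= r * `|chi a - chi b| by apply: mulr_ge0 => //; exact: ltW.
have : 0 < r / r' by rewrite divr_gt0.
nra.
Qed.

End canonical_distortion.

(** * Sums over lattices *)

Section lattice_sums.
Context {R : realType}.

Lemma powRN_le (c x y s : R) : 0 < c -> 0 < x -> 0 <= s -> x <= c * y ->
  y `^ (- s) <= c `^ s * x `^ (- s).
Proof.
move=> c0 x0 s0 xcy.
have y0 : 0 < y by move: (lt_le_trans x0 xcy); rewrite pmulr_rgt0.
rewrite !powRN ler_pdivlMr ?powR_gt0// ler_pdivrMl ?powR_gt0//.
rewrite -(powRM s (ltW y0) (ltW c0)) mulrC.
apply: ge0_ler_powR => //; rewrite nnegrE; first exact: ltW.
by rewrite mulr_ge0// ltW.
Qed.

(* Convexity of [x `^ (1 - p)], in the form used to telescope. *)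
Lemma powRN_telescope (p : R) k : 1 < p ->
  (p - 1) * (k.+2%:R : R) `^ (- p) <=
  k.+1%:R `^ (1 - p) - k.+2%:R `^ (1 - p).
Proof.
move=> p1; set q := p - 1; have q0 : 0 < q by rewrite subr_gt0.
have -> : 1 - p = - q by rewrite opprB.
have k1 : 0 < k.+1%:R :> R by [].
have k2 : 0 < k.+2%:R :> R by [].
have -> : (k.+2%:R : R) `^ (- p) = k.+2%:R `^ (- q) * k.+2%:R^-1.
  rewrite -[in RHS]powR_inv1// -powRD; last by rewrite pnatr_eq0 implybT.
  by congr (_ `^ _); rewrite /q; ring.
(* Without the common factor the claim is [1 + q / (k + 2) <= ((k + 1) / (k + 2))^(-q)], a
   consequence of [1 + x <= exp x] and [ln (1 - t) <= - t] at [t = 1 / (k + 2)]. *)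
rewrite mulrCA lerBrDl -[X in X + _]mulr1 -mulrDr.
have -> : (k.+1%:R : R) `^ (- q) = k.+2%:R `^ (- q) * (k.+1%:R / k.+2%:R) `^ (- q).
  by rewrite -powRM ?divr_ge0// mulrC mulfVK ?gt_eqF.
apply: ler_wpM2l; first exact: powR_ge0.
rewrite /powR gt_eqF ?divr_gt0//; apply: le_trans (expR_ge1Dx _) _.
rewrite ler_expR mulNr -mulrN ler_wpM2l ?(ltW q0)// lerNr.
have -> : k.+1%:R / k.+2%:R = 1 + - (k.+2%:R^-1) :> R.
  by rewrite -[X in X / _ = _](addrK 1) natr1 mulrBl divff ?pnatr_eq0// mul1r.
by apply: le_ln1Dx; rewrite ltrN2 invf_lt1// ltr1n.
Qed.

(** The integral-test bound for zeta(p): the first term is 1 and the others telescope. *)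
Lemma sum_powRN_le (p : R) K : 1 < p ->
  \sum_(k < K) (k.+1%:R : R) `^ (- p) <= 1 + (p - 1)^-1.
Proof.
move=> p1; have q0 : 0 < p - 1 by rewrite subr_gt0.
case: K => [|K]; first by rewrite big_ord0 addr_ge0// invr_ge0 ltW.
rewrite big_ord_recl/= powR1 lerD2l -[leRHS]mul1r ler_pdivlMr// mulrC mulr_sumr.
apply: (@le_trans _ _ (\sum_(k < K) ((k.+1%:R : R) `^ (1 - p) - k.+2%:R `^ (1 - p)))).
  by apply: ler_sum => k _; rewrite /bump add1n; exact: powRN_telescope.
rewrite -(big_mkord xpredT (fun k => (k.+1%:R : R) `^ (1 - p) - k.+2%:R `^ (1 - p))).
rewrite (@telescope_sumr_eq _ 0 K (fun k => - (k.+1%:R : R) `^ (1 - p)))//; last first.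
  by move=> k _; rewrite opprK addrC.
by rewrite opprK powR1 addrC gerBl powR_ge0.
Qed.

(** A uniform bound over finite duplicate-free lists plays the role of convergence of a series with
    nonnegative terms; it is insensitive to order and passes through injective reindexings. *)
Lemma sum_uniq_nat_le (f : nat -> R) (C : R) (s : seq nat) :
  (forall k, 0 <= f k) -> (forall K, \sum_(k < K) f k <= C) -> uniq s ->
  \sum_(k <- s) f k <= C.
Proof.
move=> f0 fC us.
have [K HK] : exists K, forall k, k \in s -> (k < K)%N.
  by exists (\max_(k <- s) k).+1 => k ks; rewrite ltnS; exact: (@leq_bigmax_seq _ _ xpredT id).
apply: le_trans (fC K); rewrite -(big_mkord xpredT f) [leRHS](bigID (mem s))/=.
rewrite -[X in _ <= X + _]big_filter [X in _ <= X + _](perm_big s)/=.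
  by rewrite lerDl sumr_ge0.
apply: uniq_perm => // [|k]; first by rewrite filter_uniq// iota_uniq.
rewrite mem_filter mem_index_iota andbC; case: (boolP (k \in s)) => ks; last by rewrite andbF.
by rewrite andbT leq0n HK.
Qed.

(** [absz] is injective on the nonnegative and on the negative integers separately, hence two copies
    of [C]. *)
Lemma sum_uniq_int_le (f : nat -> R) (C : R) (s : seq int) :
  (forall k, 0 <= f k) -> (forall K, \sum_(k < K) f k <= C) -> uniq s ->
  \sum_(k <- s) f `|k|%N <= C + C.
Proof.
move=> f0 fC us; rewrite (bigID (fun k : int => 0 <= k))/=.
rewrite -[X in X + _]big_filter -[X in _ + X]big_filter.
by apply: lerD; rewrite -(big_map absz xpredT f); apply: sum_uniq_nat_le => //;
  rewrite map_inj_in_uniq ?filter_uniq// => a b; rewrite !mem_filter; lia.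
Qed.

(** The point is uniformity in [y]. With [m] the integer part of [y], [1 + |k - m|] is at most twice
    [1 + |k - y|], and the shift by [m] merely reindexes the list. *)
Lemma sum_int_translate (p : R) : 1 < p ->
  exists C : R, forall (y : R) (s : seq int), uniq s ->
    \sum_(k <- s) (1 + `|k%:~R - y|) `^ (- p) <= C.
Proof.
move=> p1; pose C := 1 + (p - 1)^-1; exists (2 `^ p * (C + C)) => y s us.
have p0 : 0 <= p by rewrite (le_trans _ (ltW p1)).
pose m := Num.floor y.
have ml : m%:~R <= y by exact: floor_le_tmp.
have mu : y < m%:~R + 1 by rewrite -[1]/(1%:~R) -intrD floorD1_gt.
apply: (@le_trans _ _ (\sum_(k <- s) 2 `^ p * (`|k - m|%N.+1%:R : R) `^ (- p))).
  apply: ler_sum => k _; apply: powRN_le => //.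
  rewrite -natr1 natr_absz intr_norm intrB.
  have := ler_normD (k%:~R - y) (y - m%:~R); rewrite addrA subrK.
  have -> : `|y - m%:~R| = y - m%:~R by rewrite ger0_norm// subr_ge0.
  have := normr_ge0 (k%:~R - y); lra.
rewrite -mulr_sumr ler_wpM2l ?powR_ge0//.
rewrite -(big_map (fun k => k - m) xpredT (fun k => (`|k|%N.+1%:R : R) `^ (- p))).
apply: (@sum_uniq_int_le (fun k => (k.+1%:R : R) `^ (- p))).
- by move=> k; exact: powR_ge0.
- by move=> K; exact: sum_powRN_le.
- by rewrite map_inj_uniq// => a b /addIr.
Qed.

Lemma sum_rV_prod_le n (g : 'I_n -> int -> R) (C : R) (F : seq 'rV[int]_n) :
  (forall i k, 0 <= g i k) ->
  (forall i (s : seq int), uniq s -> \sum_(k <- s) g i k <= C) -> uniq F ->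
  \sum_(v <- F) \prod_i g i (v ord0 i) <= C ^+ n.
Proof.
move=> g0 gC uF.
(* [s] collects all entries of vectors of [F], so [F] embeds in the box of vectors with entries in
   [s]; over the whole box the sum of products factors into a product of sums. *)
pose s := undup [seq (v : 'rV[int]_n) ord0 i | v <- F, i <- enum 'I_n].
have sE (v : 'rV[int]_n) i : v \in F -> v ord0 i \in s.
  by move=> vF; rewrite mem_undup; apply/allpairsP; exists (v, i); rewrite mem_enum.
(* Positions in [s] are cast into a type with one extra slot, which is never empty; [h] vanishes on
   that slot, so nothing is added to the sums. *)
pose idx (v : 'rV[int]_n) : {ffun 'I_n -> 'I_(size s).+1} :=
  [ffun i => inord (index (v ord0 i) s)].
have idxK v i : v \in F -> nth 0 s (idx v i) = v ord0 i.
  by move=> vF; rewrite ffunE inordK ?nth_index ?sE// ltnS index_size.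
pose h i k := if (k < size s)%N then g i (nth 0 s k) else 0.
have h0 i k : 0 <= h i k by rewrite /h; case: ifP.
apply: (@le_trans _ _ (\sum_(v <- F) \prod_i h i (idx v i))).
  rewrite big_seq [leRHS]big_seq; apply: ler_sum => v vF.
  apply: ler_prod => i _; rewrite g0/= /h idxK//.
  by rewrite ffunE inordK ?ltnS ?index_size// index_mem sE.
rewrite -(big_map idx xpredT (fun e : {ffun 'I_n -> 'I_(size s).+1} => \prod_i h i (e i))).
have uidx : uniq (map idx F).
  rewrite map_inj_in_uniq// => u v uF' vF /ffunP E; apply/rowP => i.
  by rewrite -(idxK u)// E idxK.
rewrite big_uniq//=.
apply: (@le_trans _ _ (\sum_(e : {ffun 'I_n -> 'I_(size s).+1}) \prod_i h i (e i))).
  rewrite [leRHS](bigID (mem (map idx F)))/= lerDl.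
  by apply: sumr_ge0 => e _; exact: prodr_ge0.
rewrite -(bigA_distr_bigA (fun i (j : 'I_(size s).+1) => h i j))/=.
rewrite -[n in leRHS]card_ord -prodr_const.
apply: ler_prod => i _; rewrite sumr_ge0//= big_ord_recr/= /h ltnn addr0.
rewrite (eq_bigr (fun k : 'I_(size s) => g i (nth 0 s k))); last first.
  by move=> k _; rewrite ltn_ord.
rewrite -(big_mkord xpredT (fun k => g i (nth 0 s k))) -(big_nth 0 xpredT (g i)).
by apply: gC; exact: undup_uniq.
Qed.

End lattice_sums.

Section lattice_convolution.
Context {R : realType}.

(* [(1 + |u|) `^ (- s)] is at most the product of the
   [(1 + |u_i|) `^ (- s / n)], whose sums over the integers converge. *)
Lemma lattice_sum_bound n (A : 'M[R]_n) (s : R) : A \in unitmx -> n%:R < s ->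
  exists C : R, forall (F : seq 'rV[int]_n) (z : 'rV[R]_n), uniq F ->
    \sum_(k <- F) (1 + `|map_mx intr k *m A^T - z|) `^ (- s) <= C.
Proof.
move=> uA ns; have s0 : 0 < s by rewrite (le_lt_trans _ ns).
pose p := s / n%:R.
(* For [n = 0] the division makes [p] equal to 0, so the one-dimensional estimate is claimed for
   positive [n] only. *)
have [C HC] : exists C : R, (0 < n)%N -> forall (y : R) (t : seq int), uniq t ->
    \sum_(k <- t) (1 + `|k%:~R - y|) `^ (- p) <= C.
  have [n0|n0] := posnP n; first by exists 0.
  have [|C HC] := @sum_int_translate R p; last by exists C.
  by rewrite /p ltr_pdivlMr ?ltr0n// mul1r.
(* Multiplying by [B] turns the lattice into the integer lattice. Since [|v *m B| <= n * |v| * |B|],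
   the constant [c] compares the weights before and after this change of variables. *)
pose B := invmx A^T; pose c : R := 1 + n%:R * `|B|.
have c0 : 0 < c by rewrite ltr_pwDl// mulr_ge0.
exists (c `^ s * C ^+ n) => F z uF.
pose y := z *m B.
pose g (i : 'I_n) (k : int) : R := (1 + `|k%:~R - y ord0 i|) `^ (- p).
apply: (@le_trans _ _ (\sum_(k <- F) c `^ s * \prod_i g i (k ord0 i))); last first.
  rewrite -mulr_sumr ler_wpM2l ?powR_ge0//; apply: sum_rV_prod_le => //.
    by move=> i k; exact: powR_ge0.
  by move=> i t ut; apply: HC => //; exact: leq_ltn_trans (ltn_ord i).
apply: ler_sum => k _; set v := map_mx intr k *m A^T - z.
set u : 'rV[R]_n := map_mx intr k - y.
have uE : u = v *m B.
  by rewrite /v mulmxBl mulmxK// unitmx_tr.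
have u0 : 0 < 1 + `|u| by rewrite ltr_pwDl.
apply: (@le_trans _ _ (c `^ s * (1 + `|u|) `^ (- s))).
  apply: powRN_le => //; first exact: ltW.
  have : `|u| <= n%:R * (`|v| * `|B|).
    rewrite uE; apply: norm_rV_le => [|i]; first by rewrite !mulr_ge0.
    by apply: norm_mulmx_coord => *; exact: le_mx_norm.
  have : 0 <= n%:R * `|B| by rewrite mulr_ge0.
  rewrite /c; have := normr_ge0 v; nra.
apply: ler_wpM2l; first exact: powR_ge0.
have [n0|n0] := posnP n.
  rewrite big1 => [|i _]; last by have := ltn_ord i; rewrite [X in (_ < X)%N]n0.
  rewrite powRN invf_le1 ?powR_gt0// -[leLHS](powRr0 (1 + `|u|)).
  by apply: ler_powR; [rewrite lerDl|exact: ltW].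
have -> : - s = (- p) * n%:R by rewrite /p mulNr mulfVK// pnatr_eq0 -lt0n.
rewrite powRrM powR_mulrn ?powR_ge0// -[n in _ ^+ n]card_ord -prodr_const.
apply: ler_prod => i _; rewrite powR_ge0/= /g.
have -> : (k ord0 i)%:~R - y ord0 i = u ord0 i :> R by rewrite /u !mxE.
have : (1 + `|u|) `^ (- p) <= 1 `^ p * (1 + `|u ord0 i|) `^ (- p).
  apply: powRN_le => //.
  - by rewrite divr_ge0// ltW.
  - by rewrite mul1r lerD2l le_coord_norm.
by rewrite powR1 mul1r.
Qed.

(* Either [X] or [C0 * Y] is at least [Z / 2]. *)
Lemma powRN_split (X Y Z C0 s s1 s2 : R) : 0 < C0 -> 0 < s -> s <= s1 -> s <= s2 ->
  1 <= X -> 1 <= Y -> 0 < Z -> Z <= X + C0 * Y ->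
  X `^ (- s1) * Y `^ (- s2) <=
  (2 * (1 + C0)) `^ s * Z `^ (- s) * (X `^ (- s) + Y `^ (- s)).
Proof.
move=> C00 s0 ss1 ss2 X1 Y1 Z0 ZXY; set c := 2 * (1 + C0).
have c0 : 0 < c by rewrite mulr_gt0// addr_gt0.
have mono (x t : R) : 1 <= x -> s <= t -> x `^ (- t) <= x `^ (- s).
  by move=> x1 st; apply: ler_powR => //; rewrite lerN2.
have X0 := powR_ge0 X (- s); have Y0 := powR_ge0 Y (- s).
have cZ : 0 <= c `^ s * Z `^ (- s) by rewrite mulr_ge0 ?powR_ge0.
apply: (@le_trans _ _ (X `^ (- s) * Y `^ (- s))).
  by apply: ler_pM; [exact: powR_ge0|exact: powR_ge0|exact: mono|exact: mono].
have [XleY|YltX] := leP X (C0 * Y).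
  apply: (@le_trans _ _ (X `^ (- s) * (c `^ s * Z `^ (- s)))).
    apply: ler_wpM2l => //; apply: powRN_le => //; first exact: ltW.
    by rewrite /c; nra.
  by rewrite mulrC; apply: ler_wpM2l => //; rewrite lerDl.
apply: (@le_trans _ _ ((c `^ s * Z `^ (- s)) * Y `^ (- s))).
  apply: ler_wpM2r => //; apply: powRN_le => //; first exact: ltW.
  by rewrite /c; nra.
by apply: ler_wpM2l => //; rewrite lerDr.
Qed.

Lemma shifted_norm_triangle (V : normedModType R) (a b c : V) :
  1 + `|a - c| <= (1 + `|a - b|) + (1 + `|b - c|).
Proof.
have := ler_normD (a - b) (b - c); rewrite addrA subrK.
by set x := `|_|; set y := `|_|; set z := `|_|; lra.
Qed.

Lemma lattice_convolution n (A : 'M[R]_n) (chi : 'rV[R]_n -> 'rV[R]_n)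
    (C0 s1 s2 : R) :
  A \in unitmx -> bijective chi -> 0 < C0 ->
  (forall a b, 1 + `|chi a - chi b| <= C0 * (1 + `|a - b|)) ->
  (forall a b, 1 + `|a - b| <= C0 * (1 + `|chi a - chi b|)) ->
  n%:R < s1 -> n%:R < s2 ->
  exists C : R, forall (F : seq 'rV[int]_n) (a b : 'rV[R]_n), uniq F ->
    \sum_(k <- F) (1 + `|b - chi (map_mx intr k *m A^T)|) `^ (- s1) *
                  (1 + `|map_mx intr k *m A^T - a|) `^ (- s2) <=
    C * (1 + `|b - chi a|) `^ (- Num.min s1 s2).
Proof.
move=> uA [chi' chiK chi'K] C00 Cup Clow ns1 ns2; set s := Num.min s1 s2.
have ns : n%:R < s by rewrite lt_min ns1.
have s0 : 0 < s by rewrite (le_lt_trans _ ns).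
have [C HC] := lattice_sum_bound uA ns.
pose c := 2 * (1 + C0).
have c0 : 0 < c by rewrite mulr_gt0// addr_gt0.
exists (c `^ s * (C0 `^ s * C + C)) => F a b uF.
have w1 (v : 'rV[R]_n) : 1 <= 1 + `|v| by rewrite lerDl.
have w0 (v : 'rV[R]_n) : 0 < 1 + `|v| by rewrite ltr_pwDl.
set Z := 1 + `|b - chi a|.
pose X (k : 'rV[int]_n) := 1 + `|b - chi (map_mx intr k *m A^T)|.
pose Y (k : 'rV[int]_n) := 1 + `|map_mx intr k *m A^T - a|.
have XY k : X k `^ (- s1) * Y k `^ (- s2) <=
    c `^ s * Z `^ (- s) * (X k `^ (- s) + Y k `^ (- s)).
  apply: powRN_split => //.
  - by rewrite ge_min lexx.
  - by rewrite ge_min lexx orbT.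
  - exact: w1.
  - exact: w1.
  - exact: w0.
  - apply: (@le_trans _ _ (X k + (1 + `|chi (map_mx intr k *m A^T) - chi a|))).
      exact: shifted_norm_triangle.
    by rewrite lerD2l; exact: Cup.
apply: (le_trans (ler_sum _ (fun k _ => XY k))).
rewrite -mulr_sumr big_split/= mulrAC; apply: ler_wpM2r; first exact: powR_ge0.
apply: ler_wpM2l; first exact: powR_ge0.
apply: lerD; last exact: HC.
(* [Clow] at the lattice point and [chi' b] recentres the first family at [chi' b], so that [HC]
   applies to it as well. *)
apply: (@le_trans _ _ (\sum_(k <- F)
    C0 `^ s * (1 + `|map_mx intr k *m A^T - chi' b|) `^ (- s))).
  apply: ler_sum => k _; apply: powRN_le; [by []|exact: w0|exact: ltW|].
  by rewrite /X -{2}(chi'K b) [X in _ <= _ * (1 + X)]distrC; exact: Clow.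
by rewrite -mulr_sumr; apply: ler_wpM2l; [exact: powR_ge0|exact: HC].
Qed.

End lattice_convolution.

(** * Schwartz functions *)

Section complex_norm.
Context {R : realType}.
Implicit Types x y : R[i].

Lemma normcE x : normc x = Num.sqrt (complex.Re x ^+ 2 + complex.Im x ^+ 2).
Proof. by case: x. Qed.

Lemma sqr_normc x : normc x ^+ 2 = complex.Re x ^+ 2 + complex.Im x ^+ 2.
Proof. by rewrite normcE sqr_sqrtr// addr_ge0 ?sqr_ge0. Qed.

Lemma normc_ge0 x : 0 <= normc x.
Proof. by rewrite normcE sqrtr_ge0. Qed.

Lemma normcD x y : normc (x + y) <= normc x + normc y.
Proof.
have := ler_normD x y; rewrite !normc_def -!normcE.
by rewrite -(rmorphD (@real_complex_def R (Phant R))) lecR.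
Qed.

Lemma normc_sum (I : Type) (s : seq I) (F : I -> R[i]) :
  normc (\sum_(i <- s) F i) <= \sum_(i <- s) normc (F i).
Proof.
elim: s => [|i s IH]; first by rewrite !big_nil normc0.
by rewrite !big_cons (le_trans (normcD _ _))// lerD2l.
Qed.

Lemma normc_real (a : R) : normc a%:C%C = `|a|.
Proof. by rewrite normcE/= expr0n addr0 sqrtr_sqr. Qed.

Lemma normc_conj x : normc (conjc x) = normc x.
Proof. by rewrite !normcE; case: x => a b /=; rewrite sqrrN. Qed.

Lemma le_Re_normc x : `|complex.Re x| <= normc x.
Proof. by rewrite normcE -sqrtr_sqr ler_sqrt ?lerDl ?addr_ge0 ?sqr_ge0. Qed.

Lemma le_Im_normc x : `|complex.Im x| <= normc x.
Proof. by rewrite normcE -sqrtr_sqr ler_sqrt ?lerDr ?addr_ge0 ?sqr_ge0. Qed.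

Lemma normc_le x : normc x <= `|complex.Re x| + `|complex.Im x|.
Proof.
rewrite normcE -[leRHS]ger0_norm ?addr_ge0// -sqrtr_sqr ler_sqrt ?sqr_ge0//.
rewrite sqrrD !real_normK ?num_real// addrAC lerDl.
by rewrite mulrn_wge0// mulr_ge0.
Qed.

Lemma ReM x y : complex.Re (x * y) =
  complex.Re x * complex.Re y - complex.Im x * complex.Im y.
Proof. by case: x; case: y. Qed.

Lemma ImM x y : complex.Im (x * y) =
  complex.Re x * complex.Im y + complex.Im x * complex.Re y.
Proof. by case: x; case: y. Qed.

Lemma ReD x y : complex.Re (x + y) = complex.Re x + complex.Re y.
Proof. by case: x; case: y. Qed.

Lemma ImD x y : complex.Im (x + y) = complex.Im x + complex.Im y.
Proof. by case: x; case: y. Qed.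

Lemma complex_eq x y : complex.Re x = complex.Re y ->
  complex.Im x = complex.Im y -> x = y.
Proof. by case: x; case: y => /= a b c e -> ->. Qed.

End complex_norm.

Section rapid_decay.
Context {R : realType} (d : nat).
Local Notation point := 'rV[R]_d.

Definition rapid (f : point -> R) : Prop :=
  forall N : nat, exists M, forall t, (1 + `|t|) ^+ N * `|f t| <= M.

Lemma rapidD f g : rapid f -> rapid g -> rapid (fun x => f x + g x).
Proof.
move=> rf rg N; have [M HM] := rf N; have [M' HM'] := rg N.
exists (M + M') => t; rewrite (le_trans _ (lerD (HM t) (HM' t)))// -mulrDr.
by rewrite ler_wpM2l ?ler_normD// exprn_ge0// addr_ge0.
Qed.

Lemma rapidM f g : bounded_fct f -> rapid g -> rapid (fun x => f x * g x).
Proof.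
move=> [B HB] rg N; have [M HM] := rg N; exists (B * M) => t.
by rewrite normrM mulrCA ler_pM// mulr_ge0// exprn_ge0// addr_ge0.
Qed.

Lemma rapid0 : rapid (fun=> 0).
Proof. by move=> N; exists 0 => t; rewrite normr0 mulr0. Qed.

(** Peetre's inequality: [1 + |t| <= (1 + |x|) (1 + |t - x|)]. *)
Lemma rapid_shift f (x : point) : rapid f -> rapid (f \o (fun t => - x + t)).
Proof.
move=> rf N; have [M HM] := rf N; exists ((1 + `|x|) ^+ N * M) => t /=.
apply: (@le_trans _ _ ((1 + `|x|) ^+ N * ((1 + `|- x + t|) ^+ N * `|f (- x + t)|))).
  rewrite mulrA ler_wpM2r// -exprMn lerXn2r ?nnegrE ?mulr_ge0 ?addr_ge0//.
  have := ler_normD x (- x + t); rewrite addNKr.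
  have : 0 <= `|x| * `|- x + t| by rewrite mulr_ge0.
  by rewrite mulrDl mul1r mulrDr mulr1; set a := _ * _; lra.
by rewrite ler_wpM2l// exprn_ge0// addr_ge0.
Qed.

Lemma monomial_le a (t : point) : `|monomial a t| <= (1 + `|t|) ^+ size a.
Proof.
elim: a => [|i a IH]; first by rewrite /monomial big_nil normr1 expr0.
rewrite /monomial big_cons normrM exprS ler_pM//.
by rewrite (le_trans (le_coord_norm t i))// lerDr.
Qed.

Lemma monomial_nseq N i (t : point) : monomial (nseq N i) t = t ord0 i ^+ N.
Proof. by rewrite /monomial big_nseq iter_mulr_1. Qed.

Lemma norm_rV_attained (t : point) : 0 < `|t| -> exists i, `|t| = `|t ord0 i|.
Proof.
move=> t0; have : mx_norm t != 0 by rewrite gt_eqF.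
by move=> /mx_norm_neq0[[i j] E]; exists j; rewrite [LHS]E/= (ord1 i).
Qed.

(** Either [|t| <= 1], or [1 + |t|] is at most twice the coordinate attaining the norm. Only pure
    powers of single coordinates occur, so finitely many simple seminorms control the left side. *)
Lemma weight_le N (t : point) :
  (1 + `|t|) ^+ N <= 2 ^+ N * (1 + \sum_i `|t ord0 i| ^+ N).
Proof.
have S0 : 0 <= \sum_i `|t ord0 i| ^+ N by apply: sumr_ge0 => i _; exact: exprn_ge0.
have [t1|t1] := leP `|t| 1.
  apply: (@le_trans _ _ (2 ^+ N)).
    by rewrite lerXn2r ?nnegrE ?addr_ge0// -[2]/(1 + 1) lerD2l.
  by rewrite ler_peMr ?exprn_ge0// lerDl.
have [i E] := norm_rV_attained (lt_trans ltr01 t1).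
apply: (@le_trans _ _ (2 ^+ N * `|t ord0 i| ^+ N)).
  rewrite -exprMn lerXn2r ?nnegrE ?addr_ge0 ?mulr_ge0// -E.
  by rewrite [2 * _]mulrDl !mul1r lerD2r ltW.
rewrite ler_wpM2l ?exprn_ge0// (le_trans _ (_ : \sum_i `|t ord0 i| ^+ N <= _)) ?lerDr//.
by apply: (@le_sumr_term _ _ (fun i => `|t ord0 i| ^+ N)) => j; exact: exprn_ge0.
Qed.

(** Monomials are the weights in [schwartz]; powers of [1 + |t|] are the ones that behave well under
    translation. *)
Lemma rapidP f : rapid f <->
  forall a, exists M, forall t, `|monomial a t| * `|f t| <= M.
Proof.
split=> [rf a|H N].
  have [M HM] := rf (size a); exists M => t; apply: le_trans (HM t).
  by rewrite ler_wpM2r// monomial_le.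
have B i : {M | forall t : point, `|t ord0 i| ^+ N * `|f t| <= M}.
  apply: cid; have [M HM] := H (nseq N i); exists M => t.
  by have := HM t; rewrite monomial_nseq normrX.
have [M0 HM0] := H [::].
exists (2 ^+ N * (M0 + \sum_i sval (B i))) => t.
apply: le_trans (ler_wpM2r (normr_ge0 _) (weight_le N t)) _.
rewrite -mulrA ler_wpM2l ?exprn_ge0// mulrDl mul1r mulr_suml lerD//.
  by have := HM0 t; rewrite /monomial big_nil normr1 mul1r.
by apply: ler_sum => i _; exact: (svalP (B i)).
Qed.

End rapid_decay.

Section schwartz_closure.
Context {R : realType} (d : nat).
Local Notation point := 'rV[R]_d.
Local Notation C := R[i].
Local Notation rapidly_regular := (fun f : point -> R => forall k, regular (@rapid R d) k f).

Lemma schwartz_regular (f : point -> C) : schwartz f <->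
  rapidly_regular (re_part f) /\ rapidly_regular (im_part f).
Proof.
split=> [[sre sim H]|[rre rim]].
  split; apply/regularP => b; (split; [by move=> x; apply: sre || apply: sim|]);
    apply/rapidP => a; have [M HM] := H (a, b); exists M => t;
    apply: le_trans (HM t); rewrite /schwartz_weight normcM normc_real ler_wpM2l//.
  - exact: (le_Re_normc (cpartials b f t)).
  - exact: (le_Im_normc (cpartials b f t)).
have /regularP rre' := rre; have /regularP rim' := rim.
split; [by move=> a x; exact: (rre' a).1|by move=> a x; exact: (rim' a).1|].
move=> [a b].
have /rapidP/(_ a)[M HM] := (rre' b).2; have /rapidP/(_ a)[M' HM'] := (rim' b).2.
exists (M + M') => t; apply: le_trans (lerD (HM t) (HM' t)).
rewrite /schwartz_weight normcM normc_real -mulrDr ler_wpM2l//.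
exact: (normc_le (cpartials b f t)).
Qed.

Lemma rapidly_regularD (f g : point -> R) : rapidly_regular f ->
  rapidly_regular g -> rapidly_regular (fun x => f x + g x).
Proof. by move=> rf rg k; apply: regularD => //; exact: rapidD. Qed.

Lemma rapidly_regularM (f g : point -> R) :
  (forall k, regular (@bounded_fct R d) k f) ->
  rapidly_regular g -> rapidly_regular (fun x => f x * g x).
Proof.
move=> rf rg k; apply: (@regularM _ _ (@bounded_fct R d)) => //.
  exact: rapidD.
exact: rapidM.
Qed.

Lemma schwartzMl (m f : point -> C) :
  (forall k, regular (@bounded_fct R d) k (re_part m)) ->
  (forall k, regular (@bounded_fct R d) k (im_part m)) ->
  schwartz f -> schwartz (fun t => m t * f t).
Proof.
move=> mre mim /schwartz_regular[fre fim]; apply/schwartz_regular; split.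
- have -> : re_part (fun t => m t * f t) = fun t => re_part m t * re_part f t +
      (-1) * (im_part m t * im_part f t).
    by apply/funext => t; rewrite mulN1r; exact: ReM.
  apply: rapidly_regularD; first exact: rapidly_regularM.
  apply: rapidly_regularM; last exact: rapidly_regularM.
  by move=> k; apply: regular_cst; exact: bounded_fct_cst.
- have -> : im_part (fun t => m t * f t) = fun t => re_part m t * im_part f t +
      im_part m t * re_part f t.
    by apply/funext => t; exact: ImM.
  by apply: rapidly_regularD; exact: rapidly_regularM.
Qed.

Lemma schwartzD (f g : point -> C) : schwartz f -> schwartz g ->
  schwartz (fun t => f t + g t).
Proof.
move=> /schwartz_regular[fre fim] /schwartz_regular[gre gim].
apply/schwartz_regular; split.
- have -> : re_part (fun t => f t + g t) = fun t => re_part f t + re_part g t.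
    by apply/funext => t; exact: ReD.
  exact: rapidly_regularD.
- have -> : im_part (fun t => f t + g t) = fun t => im_part f t + im_part g t.
    by apply/funext => t; exact: ImD.
  exact: rapidly_regularD.
Qed.

Lemma schwartzZ (a : C) (f : point -> C) : schwartz f -> schwartz (fun t => a * f t).
Proof.
by apply: (@schwartzMl (fun=> a)) => k; apply: regular_cst; exact: bounded_fct_cst.
Qed.

Lemma schwartz_conj (f : point -> C) : schwartz f -> schwartz (fun t => conjc (f t)).
Proof.
move=> /schwartz_regular[fre fim]; apply/schwartz_regular; split.
- have -> // : re_part (fun t => conjc (f t)) = re_part f.
  by apply/funext => t; rewrite /re_part; case: (f t).
- have -> : im_part (fun t => conjc (f t)) = fun t => -1 * im_part f t.
    by apply/funext => t; rewrite mulN1r /im_part; case: (f t).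
  apply: rapidly_regularM => // k.
  by apply: regular_cst; exact: bounded_fct_cst.
Qed.

Lemma rapidly_regular_shift (f : point -> R) (x : point) : rapidly_regular f ->
  rapidly_regular (f \o (fun t => - x + t)).
Proof.
move=> rf k; apply: (@regular_comp _ _ _ (@rapid R d) _ (@bounded_fct R d)) => //.
- exact: rapidD.
- exact: rapid0.
- exact: rapidM.
- by move=> g; exact: rapid_shift.
- move=> k' i j.
  have -> : partial i (fun z => (- x + z) ord0 j) = fun=> (i == j)%:R.
    apply/funext => z.
    apply: (etrans (partial_shift _ _ _ (fun u => differentiable_coord u ord0 j))).
    exact: partial_coord.
  by apply: regular_cst; exact: bounded_fct_cst.
Qed.

Lemma schwartz_shift (f : point -> C) (x : point) : schwartz f ->
  schwartz (fun t => f (t - x)).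
Proof.
move=> /schwartz_regular[fre fim].
have -> : (fun t => f (t - x)) = (fun t => f (- x + t)).
  by apply/funext => t; rewrite addrC.
apply/schwartz_regular; split.
- exact: (rapidly_regular_shift x fre).
- exact: (rapidly_regular_shift x fim).
Qed.

(** Cosine and sine go through one induction, each being the derivative of the other up to sign; the
    constant partial derivatives of the phase contribute only constant factors. *)
Lemma regular_cos_sin (phi : point -> R) (c : 'I_d -> R) :
  (forall t, differentiable phi t) -> (forall i t, partial i phi t = c i) ->
  forall k, regular (@bounded_fct R d) k (fun t => cos (phi t)) /\
            regular (@bounded_fct R d) k (fun t => sin (phi t)).
Proof.
move=> dphi pphi.
have dcos t : differentiable (fun t => cos (phi t)) t.
  apply: (@differentiable_comp _ _ _ _ phi cos) => //.
  by apply/derivable1_diffP; exact: derivable_cos.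
have dsin t : differentiable (fun t => sin (phi t)) t.
  apply: (@differentiable_comp _ _ _ _ phi sin) => //.
  by apply/derivable1_diffP; exact: derivable_sin.
have bcos : bounded_fct (fun t => cos (phi t)).
  by exists 1 => t; rewrite ler_norml cos_geN1 cos_le1.
have bsin : bounded_fct (fun t => sin (phi t)).
  by exists 1 => t; rewrite ler_norml sin_geN1 sin_le1.
have chain (h : R -> R) (dh : R -> R) i : (forall u : R, is_derive u (1 : R) h (dh u)) ->
    partial i (fun t => h (phi t)) = fun t => c i * dh (phi t).
  move=> Hh; apply/funext => t.
  have dh' : differentiable h (phi t).
    by apply/derivable1_diffP; have [] := Hh (phi t).
  have dhp : differentiable (h \o phi) t by exact: differentiable_comp.
  apply: (etrans (deriveE (delta_mx ord0 i) dhp)).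
  apply: (etrans (congr1 (fun l : point -> R => l (delta_mx ord0 i))
    (diff_comp (dphi t) dh'))).
  rewrite [LHS]/comp -(deriveE _ (dphi t)) -/(partial i phi t) pphi.
  rewrite -[c i]mulr1 -[c i * 1]/(c i *: (1 : R)) linearZ/= -(deriveE _ dh').
  by have [_ ->] := Hh (phi t); rewrite /GRing.scale/= mulr1.
elim=> [|k [IHc IHs]]; first by split; split.
have cst_reg a : regular (@bounded_fct R d) k (fun=> a).
  by apply: regular_cst; exact: bounded_fct_cst.
have regM := regularM (@bounded_fctD R d) (@bounded_fctM R d).
split; split => // i.
- rewrite (chain cos (fun u => - sin u) i (fun u => is_derive_cos u)).
  have -> : (fun t => c i * - sin (phi t)) = (fun t => (- c i) * sin (phi t)).
    by apply/funext => t; rewrite mulrN mulNr.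
  exact: (regM _ _ _ (cst_reg _) IHs).
- rewrite (chain sin cos i (fun u => is_derive_sin u)).
  exact: (regM _ _ _ (cst_reg _) IHc).
Qed.

Lemma schwartz_tf_shift (z : 'rV[R]_(d + d)) (g : point -> C) :
  schwartz g -> schwartz (tf_shift z g).
Proof.
move=> sg; pose e := rsubmx z.
pose phi (t : point) : R := 2 * pi * dot t e.
have phiE : phi = \sum_i (fun t : point => (2 * pi * e ord0 i) * t ord0 i : R).
  apply/funext => t; rewrite fct_sumE /phi /dot mulr_sumr.
  by apply: eq_bigr => i _; ring.
have dterm (i : 'I_d) (t : point) :
    differentiable (fun t : point => (2 * pi * e ord0 i) * t ord0 i : R) t.
  by apply: differentiableM;
    [exact: differentiable_cst|exact: differentiable_coord].
have dphi t : differentiable phi t.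
  by rewrite phiE; apply: differentiable_sum.
have pphi i t : partial i phi t = 2 * pi * e ord0 i.
  rewrite /partial phiE derive_sum; last by move=> j; exact: diff_derivable.
  rewrite (bigD1 i)//= big1 ?addr0 => [|j ji].
    apply: (etrans (congr1 (@^~ t) (partialM i (fun u => differentiable_cst _ u)
      (fun u => differentiable_coord u ord0 i)))).
    by rewrite /= partial_cst partial_coord eqxx mulr1 mul0r addr0.
  apply: (etrans (congr1 (@^~ t) (partialM i (fun u => differentiable_cst _ u)
    (fun u => differentiable_coord u ord0 j)))).
  by rewrite /= partial_cst partial_coord eq_sym (negbTE ji) mulr0 mul0r addr0.
have H := regular_cos_sin dphi pphi.
apply: (@schwartzMl (fun t => expi (phi t))) => [k|k|].
- exact: (H k).1.
- exact: (H k).2.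
- exact: schwartz_shift.
Qed.

End schwartz_closure.

(** * Integration and square integrable functions *)

Section borel_rV.
Context {R : realType} (n : nat).

Lemma measurable_rV_box (q : 'rV[R]_n) (e : R) :
  measurable [set v : 'rV[R]_n | forall i, `|v ord0 i - q ord0 i| < e].
Proof.
rewrite (_ : mkset _ = \bigcap_(i in [set: 'I_n])
   ((@rV_coord R n i) @^-1` `]q ord0 i - e, q ord0 i + e[%classic)).
  apply: fin_bigcap_measurable => [|i _]; first exact: finite_finset.
  by rewrite -[X in measurable X]setTI; apply: measurable_rV_coord.
apply/seteqP; split => v H i.
  by move=> _; have := H i; rewrite /= in_itv/= ltr_norml /rV_coord; lra.
by have := H i I; rewrite /= in_itv/= ltr_norml /rV_coord; lra.
Qed.

(** Measurable sets are generated by the coordinates, so an open set is written as the countable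
    union of the cubes with rational centre and radius [1 / (m + 1)] that it contains. *)
Lemma open_measurable_rV (O : set 'rV[R]_n) : open O -> measurable O.
Proof.
move=> oO.
pose box (p : 'rV[rat]_n * nat) : set 'rV[R]_n :=
  [set v | forall i, `|v ord0 i - (map_mx ratr p.1 : 'rV[R]_n) ord0 i| < p.2.+1%:R^-1].
pose F p := if pselect (box p `<=` O) then box p else set0.
have -> : O = \bigcup_p F p.
  apply/seteqP; split=> [x Ox|x [p _]]; last first.
    by rewrite /F; case: pselect => // sub; exact: sub.
  have /nbhs_ballP[e /= e0 eO] := open_nbhs_nbhs (conj oO Ox).
  (* A cube of radius below [e / 2] that contains [x] lies in the ball of radius [e] around [x],
     although its centre is not [x]. *)
  have [m me] : exists m : nat, m.+1%:R^-1 < e / 2.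
    exists (Num.truncn (e / 2)^-1); rewrite invf_plt ?posrE ?divr_gt0//.
    exact: Num.Theory.truncnS_gt.
  have q i : {q : rat | `|x ord0 i - ratr q| < m.+1%:R^-1}.
    apply: cid; have : x ord0 i - m.+1%:R^-1 < x ord0 i + m.+1%:R^-1.
      by rewrite ltrD2l gtrN// invr_gt0.
    move/rat_in_itvoo => [q]; rewrite in_itv/= => /andP[q1 q2]; exists q.
    by rewrite ltr_norml; move: (m.+1%:R^-1) (ratr q) q1 q2 => r q' *; apply/andP; split; lra.
  exists (\row_i sval (q i), m) => //.
  have bxx : box (\row_i sval (q i), m) x.
    by move=> i /=; rewrite !mxE; exact: (svalP (q i)).
  rewrite /F; case: pselect => // -[] y Hy; apply: eO.
  split => // i j; rewrite (ord1 i).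
  have H1 := bxx j; have H2 := Hy j; rewrite !mxE in H1 H2.
  rewrite /ball/= -(subrKA (ratr (sval (q j)))) [e]splitr.
  apply: le_lt_trans (ler_normD _ _) _.
  by apply: ltrD; apply: lt_trans me; [exact: H1|rewrite distrC; exact: H2].
apply: countable_bigcupT_measurable => //.
by move=> p; rewrite /F; case: pselect => sub; [exact: measurable_rV_box|exact: measurable0].
Qed.

Lemma continuous_measurable_rV (f : 'rV[R]_n -> R) :
  continuous f -> measurable_fun setT f.
Proof.
move=> /continuousP cf; apply: (measurability _ (RGenOInfty.measurableE R)).
move=> /= _ [_ [a ->] <-]; rewrite setTI; apply: open_measurable_rV.
exact/cf/interval_open.
Qed.

End borel_rV.

(** * An integrable weight on R^n *)

Section weight_integral.
Context {R : realType}.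

Lemma integral_oneDsqr_fin :
  (\int[@lebesgue_measure R]_x ((1 + x ^+ 2)^-1)%:E < +oo)%E.
Proof.
have -> : (\int[@lebesgue_measure R]_x ((1 + x ^+ 2)^-1)%:E =
    2%:E * \int[@lebesgue_measure R]_(x in [set x | (0 <= x)%R]) ((oneDsqr x)^-1)%:E)%E.
  apply: (@ge0_symfun_integralT R (fun x => (oneDsqr x)^-1)).
  - by move=> x; rewrite invr_ge0 addr_ge0// sqr_ge0.
  - exact: continuous_oneDsqrV.
  - by move=> x; rewrite /= /oneDsqr sqrrN.
rewrite (_ : [set x | _] = `[0, +oo[%classic); last first.
  by apply/seteqP; split => x/=; rewrite in_itv/= andbT.
by rewrite integral0y_oneDsqr -EFinM ltry.
Qed.

(** The integrable majorant for squares of Schwartz functions. Its product form lets Tonelli's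
    theorem follow the recursive construction of the measure. *)
Definition weight n (t : 'rV[R]_n) : R := \prod_i (1 + t ord0 i ^+ 2)^-1.

Lemma weight_ge0 n (t : 'rV[R]_n) : 0 <= weight t.
Proof. by apply: prodr_ge0 => i _; rewrite invr_ge0 addr_ge0// sqr_ge0. Qed.

Lemma measurable_invDsqr : measurable_fun setT (fun x : R => (1 + x ^+ 2)^-1).
Proof. by apply: continuous_measurable_fun; exact: continuous_oneDsqrV. Qed.

Lemma measurable_weight n : measurable_fun setT (@weight n).
Proof.
apply: measurable_prod => i _.
exact: (measurableT_comp measurable_invDsqr (measurable_rV_coord i)).
Qed.

Lemma weight_cons n (p : measurableTypeR R * 'rV[R]_n) :
  weight (rV_cons p) = (1 + (p.1 : R) ^+ 2)^-1 * weight p.2.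
Proof.
rewrite /weight big_ord_recl -[rV_cons p ord0 ord0]/(rV_coord ord0 (rV_cons p)).
rewrite rV_cons0; congr (_ * _); apply: eq_bigr => i _.
by rewrite -[rV_cons p ord0 _]/(rV_coord (lift ord0 i) (rV_cons p)) rV_consS.
Qed.

Lemma integral_weight n : (\int[lebesgue_rV n]_t (weight t)%:E < +oo)%E.
Proof.
elim: n => [|n IH].
  rewrite /= integral_dirac//; last by apply/measurable_EFinP; exact: measurable_weight.
  by rewrite diracT mul1e ltry.
rewrite [X in (X < _)%E](_ : _ = \int[pushforward (@lebesgue_measure R \x lebesgue_rV n)%E
   (@rV_cons R n)]_t (weight t)%:E)%E//.
rewrite (ge0_integral_pushforward (@measurable_rV_cons R n))//; last 2 first.
- by apply/measurable_EFinP; exact: measurable_weight.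
- by move=> t _; rewrite lee_fin weight_ge0.
rewrite preimage_setT fubini_tonelli1/=; last 2 first.
- apply/measurable_EFinP; apply: measurableT_comp; first exact: measurable_weight.
  exact: measurable_rV_cons.
- by move=> t; rewrite lee_fin weight_ge0.
rewrite [X in (X < _)%E](_ : _ = \int[@lebesgue_measure R]_x (((1 + x ^+ 2)^-1)%:E *
    \int[lebesgue_rV n]_t (weight t)%:E))%E; last first.
  apply: eq_integral => x _; rewrite /fubini_F -ge0_integralZl_EFin//.
  - by apply: eq_integral => v _; rewrite /= weight_cons EFinM.
  - by move=> v _; rewrite lee_fin weight_ge0.
  - by apply/measurable_EFinP; exact: measurable_weight.
  - by rewrite invr_ge0 addr_ge0// sqr_ge0.
rewrite ge0_integralZr//; last 3 first.
- by apply/measurable_EFinP; exact: measurable_invDsqr.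
- by move=> x _; rewrite lee_fin invr_ge0 addr_ge0// sqr_ge0.
- by apply: integral_ge0 => v _; rewrite lee_fin weight_ge0.
apply: lte_mul_pinfty.
- by apply: integral_ge0 => x _; rewrite lee_fin invr_ge0 addr_ge0// sqr_ge0.
- rewrite ge0_fin_numE; first exact: integral_oneDsqr_fin.
  by apply: integral_ge0 => x _; rewrite lee_fin invr_ge0 addr_ge0// sqr_ge0.
- exact: IH.
Qed.

End weight_integral.

(** * Pairings on L^2 and functionals of bounded operators *)

Section square_integrable.
Context {R : realType} {d : nat}.
Local Notation C := R[i].
Local Notation point := 'rV[R]_d.
Local Notation mu := (@lebesgue_rV R d).
Local Notation integrable_fct f := (mu.-integrable setT (EFin \o f)).
Implicit Types (f g h : point -> C) (u v : point -> R).

Lemma le_integrable_fct u v : measurable_fun setT u ->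
  (forall t, `|u t| <= v t) -> integrable_fct v -> integrable_fct u.
Proof.
move=> mu_ uv; apply: le_integrable => //; first exact/measurable_EFinP.
by move=> t _; rewrite /= lee_fin (le_trans (uv t))// ler_norm.
Qed.

Lemma integrable_fctD u v : integrable_fct u -> integrable_fct v ->
  integrable_fct (fun t => u t + v t).
Proof. by move=> iu iv; exact: (integrableD _ iu iv). Qed.

Lemma integrable_fctZ (c : R) u : integrable_fct u ->
  integrable_fct (fun t => c * u t).
Proof. by move=> iu; exact: (integrableZl _ c iu). Qed.

Definition sqf f : point -> R := fun t => normc (f t) ^+ 2.

Lemma sqf_ge0 f t : 0 <= sqf f t.
Proof. exact: sqr_ge0. Qed.

Lemma measurable_sqf f : measurable_fun setT (re_part f) ->
  measurable_fun setT (im_part f) -> measurable_fun setT (sqf f).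
Proof.
move=> mre mim; have -> : sqf f = (fun t => re_part f t ^+ 2 + im_part f t ^+ 2).
  by apply/funext => t; exact: sqr_normc.
by apply: measurable_funD; exact: measurable_funX.
Qed.

Lemma L2P f : L2 f <-> [/\ measurable_fun setT (re_part f),
  measurable_fun setT (im_part f) & integrable_fct (sqf f)].
Proof.
split=> [[mre mim fi]|[mre mim fi]]; split => //.
  apply/integrableP; split; first by apply/measurable_EFinP; exact: measurable_sqf.
  rewrite (eq_integral (fun t => (sqf f t)%:E))// => t _.
  by rewrite /= ger0_norm// sqf_ge0.
exact: (integrable_lty _ fi).
Qed.

Lemma L2_le f u : measurable_fun setT (re_part f) ->
  measurable_fun setT (im_part f) -> integrable_fct u ->
  (forall t, sqf f t <= u t) -> L2 f.
Proof.
move=> mre mim iu fu; apply/L2P; split => //.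
apply: le_integrable_fct iu; first exact: measurable_sqf.
by move=> t; rewrite ger0_norm ?sqf_ge0.
Qed.

Lemma L2_comb (a : C) f g : L2 f -> L2 g -> L2 (fun t => a * f t + g t).
Proof.
move=> /L2P[fre fim fi] /L2P[gre gim gi].
apply: (@L2_le _ (fun t => (2 * normc a ^+ 2) * sqf f t + 2 * sqf g t)).
- have -> : re_part (fun t => a * f t + g t) = fun t =>
      (complex.Re a * re_part f t - complex.Im a * im_part f t) + re_part g t.
    by apply/funext => t; rewrite /re_part ReD ReM.
  by apply: measurable_funD => //; apply: measurable_funB; exact: measurable_funM.
- have -> : im_part (fun t => a * f t + g t) = fun t =>
      (complex.Re a * im_part f t + complex.Im a * re_part f t) + im_part g t.
    by apply/funext => t; rewrite /im_part ImD ImM.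
  by apply: measurable_funD => //; apply: measurable_funD; exact: measurable_funM.
- by apply: integrable_fctD; exact: integrable_fctZ.
- move=> t; rewrite /sqf.
  apply: (@le_trans _ _ ((normc a * normc (f t) + normc (g t)) ^+ 2)).
    rewrite lerXn2r ?nnegrE ?normc_ge0//.
      by rewrite addr_ge0 ?mulr_ge0 ?normc_ge0.
    by rewrite -normcM normcD.
  have := sqr_ge0 (normc a * normc (f t) - normc (g t)).
  by move: (normc a) (normc (f t)) (normc (g t)) => x y z; nra.
Qed.

Section product.
Variables (f h : point -> C).
Hypotheses (L2f : L2 f) (L2h : L2 h).
Let fh t := f t * h t.

Lemma measurable_re_mul : measurable_fun setT (re_part fh).
Proof.
have -> : re_part fh = fun t => re_part f t * re_part h t - im_part f t * im_part h t.
  by apply/funext => t; exact: ReM.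
have [? ? _] := L2f; have [? ? _] := L2h.
by apply: measurable_funB; exact: measurable_funM.
Qed.

Lemma measurable_im_mul : measurable_fun setT (im_part fh).
Proof.
have -> : im_part fh = fun t => re_part f t * im_part h t + im_part f t * re_part h t.
  by apply/funext => t; exact: ImM.
have [? ? _] := L2f; have [? ? _] := L2h.
by apply: measurable_funD; exact: measurable_funM.
Qed.

(** The weighted inequality of arithmetic and geometric means; [c] stays free so that it can be
    optimised after integration. *)
Lemma normc_mul_le (c : R) t : 0 < c ->
  normc (fh t) <= c / 2 * sqf f t + (2 * c)^-1 * sqf h t.
Proof.
move=> c0; rewrite /fh normcM /sqf.
move: (normc (f t)) (normc (h t)) => x y.
have -> : c / 2 * x ^+ 2 + (2 * c)^-1 * y ^+ 2 =
    x * y + (2 * c)^-1 * (c * x - y) ^+ 2.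
  by field; rewrite gt_eqF.
by rewrite lerDl mulr_ge0 ?sqr_ge0// invr_ge0 mulr_ge0// ltW.
Qed.

Lemma integrable_bound (a b : R) :
  integrable_fct (fun t => a * sqf f t + b * sqf h t).
Proof.
have /L2P[_ _ ?] := L2f; have /L2P[_ _ ?] := L2h.
by apply: integrable_fctD; exact: integrable_fctZ.
Qed.

Lemma integrable_re_mul : integrable_fct (re_part fh).
Proof.
apply: le_integrable_fct (integrable_bound (1 / 2) (2 * 1)^-1).
  exact: measurable_re_mul.
by move=> t; apply: le_trans (le_Re_normc _) (normc_mul_le _ ltr01).
Qed.

Lemma integrable_im_mul : integrable_fct (im_part fh).
Proof.
apply: le_integrable_fct (integrable_bound (1 / 2) (2 * 1)^-1).
  exact: measurable_im_mul.
by move=> t; apply: le_trans (le_Im_normc _) (normc_mul_le _ ltr01).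
Qed.

(* The factor 2, absent from the Cauchy-Schwarz inequality, comes from treating
   the real and imaginary parts separately. *)
Lemma distribution_of_le : normc (distribution_of f h) <= 2 * (L2norm f * L2norm h).
Proof.
have /L2P[_ _ fi] := L2f; have /L2P[_ _ hi] := L2h.
pose a := \int[mu]_t sqf f t; pose b := \int[mu]_t sqf h t.
have a0 : 0 <= a by apply: Rintegral_ge0 => t _; exact: sqf_ge0.
have b0 : 0 <= b by apply: Rintegral_ge0 => t _; exact: sqf_ge0.
have H u (c : R) : integrable_fct u -> (forall t, `|u t| <= normc (fh t)) -> 0 < c ->
    `|\int[mu]_t u t| <= c / 2 * a + (2 * c)^-1 * b.
  move=> iu ufh c0; apply: le_trans (le_normr_Rintegral _ iu) _ => //.
  rewrite /a /b -!RintegralZl// -RintegralD//; try exact: integrable_fctZ.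
  apply: le_Rintegral => //.
  - exact: (integrable_norm iu).
  - exact: integrable_bound.
  - by move=> t _; apply: le_trans (ufh t) (normc_mul_le _ c0).
have K x : 0 <= x -> (forall c, 0 < c -> x <= c / 2 * a + (2 * c)^-1 * b) ->
    x <= Num.sqrt a * Num.sqrt b.
  move=> x0 Hx.
  have sa := sqrtr_ge0 a; have sb := sqrtr_ge0 b.
  rewrite -(sqr_sqrtr a0) -(sqr_sqrtr b0) in Hx.
  move: (Num.sqrt a) (Num.sqrt b) sa sb Hx => p q p0 q0 Hx.
  apply/ler_addgt0Pr => e e0.
  pose D := p + q + e + 1.
  have D0 : 0 < D by rewrite /D; lra.
  pose r := e / D; have r0 : 0 < r by rewrite divr_gt0.
  have rD : r * D = e by rewrite /r mulfVK// gt_eqF.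
  have r1 : r <= 1 by rewrite ler_pdivrMr// mul1r /D; lra.
  have := Hx ((q + r) / (p + r)); rewrite divr_gt0 ?ltr_wpDl// => /(_ isT).
  move=> Hx'; apply: (le_trans Hx').
  have pr : 0 < p + r by rewrite ltr_wpDl.
  have qr : 0 < q + r by rewrite ltr_wpDl.
  have -> : (q + r) / (p + r) / 2 * p ^+ 2 + (2 * ((q + r) / (p + r)))^-1 * q ^+ 2
     = 2^-1 * ((q + r) * p * (p / (p + r))) + 2^-1 * ((p + r) * q * (q / (q + r))).
    by field; rewrite !gt_eqF.
  have h1 : p / (p + r) <= 1 by rewrite ler_pdivrMr// mul1r lerDl ltW.
  have h2 : q / (q + r) <= 1 by rewrite ler_pdivrMr// mul1r lerDl ltW.
  have k1 : (q + r) * p * (p / (p + r)) <= (q + r) * p.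
    by rewrite ler_piMr// mulr_ge0// ltW.
  have k2 : (p + r) * q * (q / (q + r)) <= (p + r) * q.
    by rewrite ler_piMr// mulr_ge0// ltW.
  have rp : r * (p + q) <= e.
    by rewrite -rD ler_wpM2l ?ltW// /D; lra.
  lra.
rewrite /L2norm -/(sqf f) -/(sqf h) -/a -/b.
have -> : 2 * (Num.sqrt a * Num.sqrt b) =
    Num.sqrt a * Num.sqrt b + Num.sqrt a * Num.sqrt b by ring.
apply: (le_trans (normc_le _)); apply: lerD; apply: K => // c c0.
- by apply: H => //; [exact: integrable_re_mul|move=> t; exact: le_Re_normc].
- by apply: H => //; [exact: integrable_im_mul|move=> t; exact: le_Im_normc].
Qed.

End product.

Lemma distribution_of_combl (a : C) f g h : L2 f -> L2 g -> L2 h ->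
  distribution_of (fun t => a * f t + g t) h =
  a * distribution_of f h + distribution_of g h.
Proof.
move=> Lf Lg Lh.
have ifr := integrable_re_mul Lf Lh; have ifi := integrable_im_mul Lf Lh.
have igr := integrable_re_mul Lg Lh; have igi := integrable_im_mul Lg Lh.
apply: complex_eq; rewrite ?ReD ?ImD ?ReM ?ImM /distribution_of/=.
- rewrite -!RintegralZl// -RintegralB//; try exact: integrable_fctZ.
  rewrite -RintegralD//.
    apply: eq_Rintegral => t _; rewrite /re_part /im_part !(ReM, ReD, ImM, ImD); ring.
  by apply: (integrableB _ (integrable_fctZ _ ifr) (integrable_fctZ _ ifi)).
- rewrite -!RintegralZl// -!RintegralD//; try exact: integrable_fctZ.
    apply: eq_Rintegral => t _; rewrite /re_part /im_part !(ReM, ReD, ImM, ImD); ring.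
  by apply: integrable_fctD; exact: integrable_fctZ.
Qed.

Lemma distribution_of_combr (a : C) f g h : L2 f -> L2 g -> L2 h ->
  distribution_of h (fun t => a * f t + g t) =
  a * distribution_of h f + distribution_of h g.
Proof.
have sw f' g' : distribution_of f' g' = distribution_of g' f' :> C.
  by rewrite /distribution_of; congr cintegral; apply/funext => t; rewrite mulrC.
by move=> Lf Lg Lh; rewrite !(sw h) distribution_of_combl.
Qed.

Lemma distribution_of_ae f g h : L2 f -> L2 g -> L2 h ->
  {ae mu, forall t, f t = g t} -> distribution_of f h = distribution_of g h.
Proof.
move=> Lf Lg Lh fg; apply: complex_eq; rewrite /distribution_of/= /Rintegral; congr fine.
- apply: ae_eq_integral => //.
  + by apply/measurable_EFinP; exact: measurable_re_mul.
  + by apply/measurable_EFinP; exact: measurable_re_mul.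
  + by apply: filterS fg => t E _; rewrite /re_part E.
- apply: ae_eq_integral => //.
  + by apply/measurable_EFinP; exact: measurable_im_mul.
  + by apply/measurable_EFinP; exact: measurable_im_mul.
  + by apply: filterS fg => t E _; rewrite /im_part E.
Qed.

Lemma L2norm_ge0 f : 0 <= L2norm f.
Proof. exact: sqrtr_ge0. Qed.

Lemma L2norm_ae0 f : L2 f -> {ae mu, forall t, f t = 0} -> L2norm f = 0.
Proof.
move=> [mre mim _] f0; rewrite /L2norm -/(sqf f) (_ : \int[mu]_t sqf f t = 0) ?sqrtr0//.
rewrite /Rintegral (@ae_eq_integral _ _ _ mu setT (cst 0)) ?integral0//.
- by apply/measurable_EFinP; exact: measurable_sqf.
- by apply: filterS f0 => t E _; rewrite /sqf E normc0 expr0n.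
Qed.

Lemma L2_0 : L2 (fun _ : point => 0 : C).
Proof.
apply: (@L2_le _ (fun=> 0)).
- exact: measurable_cst.
- exact: measurable_cst.
- exact: integrable0.
- by move=> t; rewrite /sqf normc0 expr0n.
Qed.

Lemma L2_sum (I : Type) (s : seq I) (c : I -> C) (phi : I -> point -> C) :
  (forall i, L2 (phi i)) -> L2 (fun t => \sum_(i <- s) c i * phi i t).
Proof.
move=> Lphi; elim: s => [|i s IH].
  rewrite (_ : (fun t => _) = fun=> 0); first exact: L2_0.
  by apply/funext => t; rewrite big_nil.
rewrite (_ : (fun t => _) = fun t => c i * phi i t + \sum_(j <- s) c j * phi j t).
  exact: L2_comb.
by apply/funext => t; rewrite big_cons.
Qed.

Section functional.
Variables (B : (point -> C) -> (point -> C)) (h : point -> C).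
Hypotheses (Bb : bounded_L2 B) (L2h : L2 h).
Let l f := distribution_of (B f) h.

(** [B] is linear only almost everywhere; integrating against [h] makes the identity exact. *)
Lemma functional_comb (a : C) f g : L2 f -> L2 g ->
  l (fun t => a * f t + g t) = a * l f + l g.
Proof.
have [BL2 Blin _] := Bb => Lf Lg.
rewrite /l -distribution_of_combl; [|exact: BL2|exact: BL2|by []].
apply: distribution_of_ae => //; [exact/BL2/L2_comb| |exact: Blin].
by apply: L2_comb; exact: BL2.
Qed.

Lemma functional_le : exists2 K : R, 0 <= K & forall f, L2 f ->
  normc (l f) <= K * L2norm f.
Proof.
have [BL2 _ [K HK]] := Bb.
(* The constant in [bounded_L2] carries no sign, hence the maximum with 0. *)
exists (2 * (Num.max K 0 * L2norm h)) => [|f Lf].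
  by rewrite !mulr_ge0 ?L2norm_ge0// le_max lexx orbT.
apply: (le_trans (distribution_of_le (BL2 _ Lf) L2h)).
have -> : 2 * (Num.max K 0 * L2norm h) * L2norm f =
    2 * ((Num.max K 0 * L2norm f) * L2norm h) by ring.
rewrite ler_wpM2l// ler_wpM2r ?L2norm_ge0//.
by rewrite (le_trans (HK _ Lf))// ler_wpM2r ?L2norm_ge0// le_max lexx.
Qed.

Lemma functional0 : l (fun=> 0) = 0.
Proof.
have [K _ HK] := functional_le.
have := HK _ L2_0; rewrite (L2norm_ae0 L2_0); last exact/aeW.
rewrite mulr0 => l0; apply: Normc.eq0_normc; apply/eqP.
by rewrite eq_le l0 normc_ge0.
Qed.

Lemma functional_sum (I : Type) (s : seq I) (c : I -> C) (phi : I -> point -> C) :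
  (forall i, L2 (phi i)) ->
  l (fun t => \sum_(i <- s) c i * phi i t) = \sum_(i <- s) c i * l (phi i).
Proof.
move=> Lphi; elim: s => [|i s IH].
  rewrite big_nil -[RHS]functional0; congr l.
  by apply/funext => t; rewrite big_nil.
rewrite big_cons -IH -functional_comb//; last exact: L2_sum.
by congr l; apply/funext => t; rewrite big_cons.
Qed.

End functional.

End square_integrable.

Section schwartz_L2.
Context {R : realType} {d : nat}.
Local Notation C := R[i].
Local Notation point := 'rV[R]_d.
Local Notation mu := (@lebesgue_rV R d).
Implicit Types h : point -> C.

Lemma le_seminorm p h t : schwartz h -> schwartz_weight p h t <= seminorm p h.
Proof.
move=> [_ _ /(_ p)[M HM]]; apply: ub_le_sup; last by exists t.
by exists M => _ [u _ <-].
Qed.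

Lemma seminorm_ge0 p h : schwartz h -> 0 <= seminorm p h.
Proof. by move=> sh; apply: le_trans (le_seminorm p 0 sh); exact: normc_ge0. Qed.

(** The seminorms that bound [(1 + |t|)^d |h t|] through [weight_le]. The exponent [d] suffices
    because the product of the [1 + t_i^2] is at most [(1 + |t|)^(2d)]. *)
Definition L2_seminorms : seq (seq 'I_d * seq 'I_d) :=
  ([::], [::]) :: [seq (nseq d i, [::]) | i <- enum 'I_d].

Lemma sqf_le_weight h t : schwartz h ->
  sqf h t <= (2 ^+ d * \sum_(p <- L2_seminorms) seminorm p h) ^+ 2 * weight t.
Proof.
move=> sh; set M := 2 ^+ d * _.
have HM : (1 + `|t|) ^+ d * normc (h t) <= M.
  apply: le_trans (ler_wpM2r (normc_ge0 _) (weight_le d t)) _.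
  rewrite /M -mulrA ler_wpM2l ?exprn_ge0// mulrDl mul1r mulr_suml /L2_seminorms.
  have hE : cpartials [::] h t = h t by rewrite /cpartials /= /re_part /im_part; case: (h t).
  rewrite big_cons big_map big_enum/= lerD//.
    have := le_seminorm ([::], [::]) t sh.
    by rewrite /schwartz_weight normcM normc_real hE /monomial big_nil normr1 mul1r.
  apply: ler_sum => i _; have := le_seminorm (nseq d i, [::]) t sh.
  by rewrite /schwartz_weight normcM normc_real hE monomial_nseq normrX.
have M0 : 0 <= M by rewrite (le_trans _ HM)// mulr_ge0 ?normc_ge0// exprn_ge0// addr_ge0.
have P0 : 0 < \prod_(i < d) (1 + t ord0 i ^+ 2).
  by apply: prodr_gt0 => i _; rewrite ltr_pwDl// sqr_ge0.
rewrite /weight prodfV ler_pdivlMr//.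
apply: (@le_trans _ _ (sqf h t * ((1 + `|t|) ^+ d) ^+ 2)).
  rewrite ler_wpM2l ?sqf_ge0// -exprM mulnC exprM -[d in _ ^+ d]card_ord -prodr_const.
  apply: ler_prod => i _; rewrite addr_ge0 ?sqr_ge0//=.
  have : t ord0 i ^+ 2 <= `|t| ^+ 2.
    by rewrite -real_normK ?num_real// lerXn2r ?nnegrE// le_coord_norm.
  by rewrite sqrrD; have := normr_ge0 t; lra.
rewrite /sqf mulrC -exprMn lerXn2r ?nnegrE ?mulr_ge0 ?normc_ge0//.
by apply: sumr_ge0 => p _; exact: seminorm_ge0.
Qed.

Lemma integrable_weight (c : R) : mu.-integrable setT (EFin \o (fun t => c * weight t)).
Proof.
apply: integrable_fctZ; apply/integrableP; split.
  by apply/measurable_EFinP; exact: measurable_weight.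
apply: le_lt_trans (integral_weight d); apply: ge0_le_integral => //.
- by apply: measurableT_comp => //; apply/measurable_EFinP; exact: measurable_weight.
- by apply/measurable_EFinP; exact: measurable_weight.
- by move=> t _; rewrite /= ger0_norm// weight_ge0.
Qed.

Lemma measurable_smooth (f : point -> R) : smooth f -> measurable_fun setT f.
Proof.
move=> sf; apply: continuous_measurable_rV => t.
exact/differentiable_continuous/(sf [::]).
Qed.

Lemma schwartz_L2 h : schwartz h -> L2 h.
Proof.
move=> sh; have [sre sim _] := sh.
apply: (L2_le (measurable_smooth sre) (measurable_smooth sim) (integrable_weight _)).
by move=> t; exact: sqf_le_weight.
Qed.

Lemma L2norm_le_seminorms : exists2 K : R, 0 <= K & forall h, schwartz h ->
  L2norm h <= K * \sum_(p <- L2_seminorms) seminorm p h.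
Proof.
exists (2 ^+ d * Num.sqrt (\int[mu]_t weight t)) => [|h sh].
  by rewrite mulr_ge0 ?sqrtr_ge0// exprn_ge0.
have W0 : 0 <= \int[mu]_t weight t by apply: Rintegral_ge0 => t _; exact: weight_ge0.
have S0 : 0 <= \sum_(p <- L2_seminorms) seminorm p h.
  by apply: sumr_ge0 => p _; exact: seminorm_ge0.
rewrite mulrAC -[X in X * Num.sqrt _]ger0_norm; last by rewrite mulr_ge0// exprn_ge0.
rewrite -sqrtr_sqr -sqrtrM ?sqr_ge0// ler_sqrt; last by rewrite mulr_ge0// sqr_ge0.
have /L2P[_ _ hi] := schwartz_L2 sh.
rewrite -RintegralZl//; last first.
  by have := integrable_weight 1; apply: eq_integrable => // t _ /=; rewrite mul1r.
apply: le_Rintegral => //; first exact: integrable_weight.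
by move=> t _; exact: sqf_le_weight.
Qed.

End schwartz_L2.

(** * Operators and their Gabor matrices *)

Section operators.
Context {R : realType} {d : nat}.
Local Notation C := R[i].
Local Notation point := 'rV[R]_d.
Local Notation mu := (@lebesgue_rV R d).

Lemma schwartz_comb (a : C) (f g : point -> C) : schwartz f -> schwartz g ->
  schwartz (fun t => a * f t + g t).
Proof. by move=> sf sg; apply: schwartzD => //; exact: schwartzZ. Qed.

(** The difference of [u] and [v] has norm 0, so a bounded linear functional vanishes on it. *)
Lemma functional_ae (B : (point -> C) -> (point -> C)) (h u v : point -> C) :
  bounded_L2 B -> L2 h -> L2 u -> L2 v -> {ae mu, forall t, u t = v t} ->
  distribution_of (B u) h = distribution_of (B v) h.
Proof.
move=> Bb Lh Lu Lv uv.
have [K _ HK] := functional_le Bb Lh.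
have Lw := L2_comb (-1) Lv Lu.
have w0 : L2norm (fun t => -1 * v t + u t) = 0.
  by apply: L2norm_ae0 => //; apply: filterS uv => t ->; rewrite mulN1r addNr.
have := HK _ Lw; rewrite w0 mulr0 (functional_comb Bb Lh)// => H.
apply/eqP; rewrite -subr_eq0 addrC -mulN1r; apply/eqP/Normc.eq0_normc/eqP.
by rewrite eq_le H normc_ge0.
Qed.

Lemma schwartz_continuous_L2 (u : (point -> C) -> C) (K : R) : 0 <= K ->
  (forall f, schwartz f -> normc (u f) <= K * L2norm f) -> schwartz_continuous u.
Proof.
move=> K0 HK; have [K' K'0 HK'] := @L2norm_le_seminorms R d.
exists (K * K'), (@L2_seminorms d) => f sf; apply: le_trans (HK f sf) _.
by rewrite -mulrA ler_wpM2l// HK'.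
Qed.

(** The pairing [<B1 (B2 f), h>] is bounded by the L^2 norms of [f] and [h], hence by Schwartz
    seminorms in either variable. *)
Lemma composition_continuous (T1 T2 T : operator R d) :
  is_composition T1 T2 T -> continuous_operator T.
Proof.
move=> [B1 [B2 [[B1b _] [B2b _] TE]]].
have [B1L _ _] := B1b; have [B2L B2lin [K2 HK2]] := B2b.
split.
- move=> f sf; have LBf : L2 (B1 (B2 f)) by apply/B1L/B2L/schwartz_L2.
  split=> [a h h' sh sh'|].
    rewrite !TE//; last exact: schwartz_comb.
    by apply: distribution_of_combr => //; exact: schwartz_L2.
  apply: (@schwartz_continuous_L2 _ (2 * L2norm (B1 (B2 f)))) => [|h sh].
    by rewrite mulr_ge0// L2norm_ge0.
  rewrite TE// -mulrA; apply: distribution_of_le => //; exact: schwartz_L2.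
- move=> a f g h sf sg sh.
  have Lf := schwartz_L2 sf; have Lg := schwartz_L2 sg; have Lh := schwartz_L2 sh.
  rewrite !TE//; last exact: schwartz_comb.
  have Bf := B2L _ Lf; have Bg := B2L _ Lg.
  rewrite -(functional_comb B1b Lh a Bf Bg).
  (* [B2] respects the linear combination only almost everywhere, and the functional through [B1]
     does not see the difference. *)
  apply: functional_ae => //; [exact/B2L/L2_comb|exact: L2_comb|exact: B2lin].
- move=> h sh; have Lh := schwartz_L2 sh.
  have [K1 K10 HK1] := functional_le B1b Lh.
  apply: (@schwartz_continuous_L2 _ (K1 * Num.max K2 0)) => [|f sf].
    by rewrite mulr_ge0// le_max lexx orbT.
  have Lf := schwartz_L2 sf.
  rewrite TE// (le_trans (HK1 _ (B2L _ Lf)))// -mulrA ler_wpM2l//.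
  by rewrite (le_trans (HK2 _ Lf))// ler_wpM2r ?L2norm_ge0// le_max lexx.
Qed.

Lemma schwartz_continuous_scale (a : C) (u : (point -> C) -> C) :
  schwartz_continuous u -> schwartz_continuous (fun f => a * u f).
Proof.
move=> [K [P HK]]; exists (normc a * K), P => f sf.
by rewrite normcM -mulrA ler_wpM2l ?normc_ge0// HK.
Qed.

Lemma schwartz_continuousD (u v : (point -> C) -> C) :
  schwartz_continuous u -> schwartz_continuous v ->
  schwartz_continuous (fun f => u f + v f).
Proof.
(* Absolute values, since the constants may be negative while each sum of seminorms is enlarged. *)
move=> [K [P HK]] [L [Q HL]]; exists (`|K| + `|L|), (P ++ Q) => f sf.
have s0 S : 0 <= \sum_(p <- S) seminorm p f.
  by apply: sumr_ge0 => p _; exact: seminorm_ge0.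
rewrite (le_trans (normcD _ _))// (le_trans (lerD (HK f sf) (HL f sf)))//.
rewrite big_cat/= mulrDl lerD//.
  by rewrite mulrDr -[leLHS]addr0 lerD ?mulr_ge0// ler_wpM2r// ler_norm.
by rewrite mulrDr -[leLHS]add0r lerD ?mulr_ge0// ler_wpM2r// ler_norm.
Qed.

Lemma continuous_operator_scale (a : C) (T : operator R d) :
  continuous_operator T -> continuous_operator (scale_operator a T).
Proof.
move=> [tT lT cT]; split=> [f sf|b f g h sf sg sh|h sh].
- have [lin cont] := tT f sf; split; last exact: schwartz_continuous_scale.
  by move=> b u v su sv; rewrite /scale_operator lin//; ring.
- by rewrite /scale_operator lT//; ring.
- exact: schwartz_continuous_scale (cT h sh).
Qed.

Lemma continuous_operatorD (T1 T2 : operator R d) : continuous_operator T1 ->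
  continuous_operator T2 -> continuous_operator (add_operator T1 T2).
Proof.
move=> [tT lT cT] [tU lU cU]; split=> [f sf|b f g h sf sg sh|h sh].
- have [lin cont] := tT f sf; have [lin' cont'] := tU f sf.
  split; last exact: schwartz_continuousD.
  by move=> b u v su sv; rewrite /add_operator lin// lin'//; ring.
- by rewrite /add_operator lT// lU//; ring.
- exact: schwartz_continuousD (cT h sh) (cU h sh).
Qed.

End operators.

(** * Gabor matrix of a composition *)

Section fio.
Context {R : realType} {d : nat}.
Local Notation C := R[i].
Local Notation point := 'rV[R]_d.
Local Notation phase := 'rV[R]_(d + d).
Variables (A : 'M[R]_(d + d)) (g : point -> C).

Lemma FIO_scale chi s (a : C) (T : operator R d) :
  FIO A g chi s T -> FIO A g chi s (scale_operator a T).
Proof.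
move=> [cT [K K0 HK]]; split; first exact: continuous_operator_scale.
(* The summand 1 keeps the constant positive when [a = 0]. *)
exists ((normc a + 1) * K) => [|l m Al Am].
  by rewrite mulr_gt0// ltr_wpDl// normc_ge0.
rewrite /bracket /scale_operator normcM -mulrA ler_pM ?normc_ge0 ?lerDl//.
exact: HK.
Qed.

Lemma FIO_add chi s (T1 T2 : operator R d) : FIO A g chi s T1 ->
  FIO A g chi s T2 -> FIO A g chi s (add_operator T1 T2).
Proof.
move=> [cT [K K0 HK]] [cU [L L0 HL]]; split; first exact: continuous_operatorD.
exists (K + L) => [|l m Al Am]; first exact: addr_gt0.
by rewrite mulrDl (le_trans (normcD _ _))// lerD// ?HK ?HL.
Qed.

Hypotheses (hA : A \in unitmx) (g_schwartz : schwartz g).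
Hypothesis g_frame : parseval_frame A g.

Let pg k := tf_shift (lattice_point A k) g.

(* A functional bounded on L^2 commutes with the frame expansion of [u]. *)
Lemma frame_functional_le (B : (point -> C) -> (point -> C)) (h u : point -> C) (X : R) :
  bounded_L2 B -> L2 h -> L2 u ->
  (forall F : {fset 'rV[int]_(d + d)},
    \sum_(k <- F) normc (inner u (pg k)) * normc (distribution_of (B (pg k)) h) <= X) ->
  normc (distribution_of (B u) h) <= X.
Proof.
move=> Bb Lh Lu HX.
have Lpg k : L2 (pg k) by apply/schwartz_L2/schwartz_tf_shift.
have [K K0 HK] := functional_le Bb Lh.
apply/ler_addgt0Pr => e e0.
(* With this tolerance the remainder of the expansion contributes at most [K * (e / (K + 1)) <= e],
   also when [K = 0]. *)
have e'0 : 0 < e / (K + 1) by rewrite divr_gt0// ltr_wpDl.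
have [F /(_ F (fsubset_refl F)) HF] := g_frame Lu e'0.
pose S t := \sum_(k <- F) inner u (pg k) * pg k t.
have LS : L2 S by exact: L2_sum.
have LuS : L2 (fun t => u t - S t).
  rewrite (_ : (fun t => _) = fun t => -1 * S t + u t); first exact: L2_comb.
  by apply/funext => t; rewrite mulN1r addrC.
have -> : u = (fun t => 1 * (u t - S t) + S t).
  by apply/funext => t; rewrite mul1r subrK.
rewrite (functional_comb Bb Lh)// mul1r addrC (le_trans (normcD _ _))//.
apply: lerD.
  rewrite (functional_sum Bb Lh)// (le_trans (normc_sum _ _))//.
  by under eq_bigr do rewrite normcM; exact: HX.
rewrite (le_trans (HK _ LuS))// (@le_trans _ _ (K * (e / (K + 1))))//.
  by rewrite ler_wpM2l// ltW.
by rewrite mulrCA ler_piMr ?(ltW e0)// ler_pdivrMr ?ltr_wpDl// mul1r lerDl.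
Qed.

Lemma composition_decay (chi1 chi2 : phase -> phase) (s1 s2 : R)
    (T1 T2 T : operator R d) :
  condB1 chi1 -> condB2 chi1 -> (2 * d)%:R < s1 -> (2 * d)%:R < s2 ->
  FIO A g chi1 s1 T1 -> FIO A g chi2 s2 T2 -> is_composition T1 T2 T ->
  FIO A g (chi1 \o chi2) (Num.min s1 s2) T.
Proof.
(* The threshold becomes [d + d], the dimension in which the lattice sums are taken. *)
rewrite mul2n -addnn => b1 b2 ns1 ns2 [_ [K1 K10 HK1]] [_ [K2 K20 HK2]] comp.
split; first exact: composition_continuous comp.
have [_ bij _] := b1.
have s10 : 0 <= s1 by rewrite (le_trans _ (ltW ns1)).
have s20 : 0 <= s2 by rewrite (le_trans _ (ltW ns2)).
set s := Num.min s1 s2.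
have s0 : 0 <= s by rewrite le_min s10.
have [C0 C00 HC0] := condB_distortion b1 b2.
have [C1 HC1] := lattice_convolution hA bij C00 (fun a b => (HC0 a b).1)
  (fun a b => (HC0 a b).2) ns1 ns2.
pose D := (K2 * 2 `^ s2) * (K1 * 2 `^ s1).
have D0 : 0 <= D by rewrite !mulr_ge0 ?powR_ge0 ?ltW.
(* The powers of 2 in [D] and the power of [(d + d).+1] convert between the Japanese bracket and
   [1 + |v|]; [C1] has no known sign, and the final 1 makes the constant positive. *)
exists (D * (`|C1| * (d + d).+1%:R `^ s) + 1) => [|l m Al Am].
  by rewrite ltr_wpDl// mulr_ge0// mulr_ge0// powR_ge0.
have [B1 [B2 [[B1b T1E] [B2b T2E] TE]]] := comp.
have [B2L _ _] := B2b.
have spg z : schwartz (tf_shift z g) by exact: schwartz_tf_shift.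
have scpg z := schwartz_conj (spg z).
rewrite /bracket TE//.
pose w (v : phase) := 1 + `|v|.
have jap (v : phase) t : 0 <= t -> japanese v `^ (- t) <= 2 `^ t * w v `^ (- t).
  by move=> t0; apply: powRN_le => //; [rewrite ltr_pwDl|exact: le_japanese].
apply: (@le_trans _ _ (D * (C1 * w (m - chi1 (chi2 l)) `^ (- s)))); last first.
  have J0 := powR_ge0 (japanese (m - chi1 (chi2 l))) (- s).
  rewrite [leRHS]mulrDl mul1r.
  apply: (@le_trans _ _ (D * (`|C1| * (d + d).+1%:R `^ s) *
      japanese (m - chi1 (chi2 l)) `^ (- s))); last by rewrite lerDl.
  rewrite -mulrA; apply: ler_wpM2l => //; rewrite -mulrA.
  apply: (@le_trans _ _ (`|C1| * w (m - chi1 (chi2 l)) `^ (- s))).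
    by apply: ler_wpM2r; [exact: powR_ge0|exact: ler_norm].
  apply: ler_wpM2l => //; apply: powRN_le => //; first exact: japanese_gt0.
  exact: japanese_le.
(* The frame expansion is applied to [B2 (pi(l) g)], and the functional is the pairing of [B1] with
   the conjugate of [pi(m) g]. *)
apply: frame_functional_le => //; [exact: schwartz_L2|exact/B2L/schwartz_L2|move=> F].
have HF := HC1 F (chi2 l) m (fset_uniq F).
apply: le_trans (ler_wpM2l D0 HF); rewrite mulr_sumr; apply: ler_sum => k _.
have Ak : lattice A (lattice_point A k) by exists k.
apply: (@le_trans _ _ ((K2 * (2 `^ s2 * w (lattice_point A k - chi2 l) `^ (- s2))) *
  (K1 * (2 `^ s1 * w (m - chi1 (lattice_point A k)) `^ (- s1))))).
  apply: ler_pM; [exact: normc_ge0|exact: normc_ge0| |].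
    (* Since [B2] represents [T2] on Schwartz functions, the frame coefficient of [B2 (pi(l) g)]
       unfolds to an entry of the Gabor matrix of [T2]; the other factor is likewise an entry for
       [T1]. *)
    have := HK2 l (lattice_point A k) Al Ak; rewrite /bracket T2E// => H.
    by apply: (le_trans H); apply: ler_wpM2l; [exact: ltW|exact: jap].
  have := HK1 (lattice_point A k) m Ak Am; rewrite /bracket T1E// => H.
  by apply: (le_trans H); apply: ler_wpM2l; [exact: ltW|exact: jap].
by rewrite !(mulrA K2) !(mulrA K1) mulrACA [X in _ * X <= _]mulrC.
Qed.

End fio.

Theorem theorem3p6 (R : realType) (d : nat)
    (A : 'M[R]_(d + d)) (hA : A \in unitmx)
    (g : 'rV[R]_d -> R[i]) (g_schwartz : schwartz g) (g_neq0 : g <> fun=> 0)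
    (g_frame : parseval_frame A g) :
  (forall (chi1 chi2 : 'rV[R]_(d + d) -> 'rV[R]_(d + d)) (s1 s2 : R)
      (T1 T2 T : operator R d),
    condB1 chi1 -> condB2 chi1 -> condB1 chi2 -> condB2 chi2 ->
    (2 * d)%:R < s1 -> (2 * d)%:R < s2 ->
    FIO A g chi1 s1 T1 -> FIO A g chi2 s2 T2 ->
    is_composition T1 T2 T ->
    FIO A g (chi1 \o chi2) (Num.min s1 s2) T) /\
  (forall s : R, (2 * d)%:R < s ->
    [/\ forall T1 T2 T : operator R d,
          FIO_union A g s T1 -> FIO_union A g s T2 ->
          is_composition T1 T2 T -> FIO_union A g s T,
        forall (a : R[i]) (T : operator R d),
          FIO_union A g s T -> FIO_union A g s (scale_operator a T) &
        forall (chi : 'rV[R]_(d + d) -> 'rV[R]_(d + d)) (T1 T2 : operator R d),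
          condB1 chi -> condB2 chi ->
          FIO A g chi s T1 -> FIO A g chi s T2 ->
          FIO A g chi s (add_operator T1 T2)]).
Proof.
split=> [chi1 chi2 s1 s2 T1 T2 T b1 b1' b2 b2' ns1 ns2 F1 F2 comp|s ns].
  exact: (composition_decay hA g_schwartz g_frame b1 b1' ns1 ns2 F1 F2 comp).
split=> [T1 T2 T [chi1 [b1 b1' F1]] [chi2 [b2 b2' F2]] comp|a T [chi [b b' F]]|].
- have [b12 b12'] := condB_comp b1 b1' b2 b2'.
  exists (chi1 \o chi2); split; [exact: b12|exact: b12'|].
  rewrite -[s](minxx s).
  exact: (composition_decay hA g_schwartz g_frame b1 b1' ns ns F1 F2 comp).
- by exists chi; split; [exact: b|exact: b'|exact: FIO_scale].
- by move=> chi T1 T2 _ _; exact: FIO_add.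
Qed.
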